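(* Two reduced operation sequences $\alpha$ and $\beta$ are equivalent if and only if there is a finite chain $\alpha=\gamma_0,\gamma_1,\dots,\gamma_r=\beta$ of operation sequences in which $\gamma_{i-1}$ and $\gamma_i$ are rise-fall related for each $i=1,\dots,r$.
   Context: Operation sequences: $\sigma[a]$ ($a\ge1$) denotes pushing the top $a$ elements of the input stack, as a block with relative order unchanged, onto the top of a working stack; $\tau[b]$ ($b\ge1$) denotes moving the top $b$ elements of the working stack, as a block with relative order unchanged, onto the top of an output stack; $\sigma=\sigma[1]$, $\tau=\tau[1]$. A well-formed operation sequence is a word $\alpha=\alpha_1\cdots\alpha_m$ in these symbols such that in every prefix the total push size is at least the total pop size, with equality for the whole word; its size $n$ is the total push size. Acting on an input stack containing $1,\dots,n$ with $1$ on top, it produces the permutation read from the final output stack top to bottom. Two well-formed sequences are equivalent if they have the same size and produce the same permutation. $\alpha$ is reduced if every consecutive pair $\alpha_i\alpha_{i+1}$ with $\alpha_i$ a push and $\alpha_{i+1}$ a pop equals $\sigma[1]\tau[1]$. The support of a push (resp. pop) is the set of elements it places on (resp. removes from) the working stack; a push and a pop correspond if their supports intersect. A rise-fall subsequence of $\alpha$ is a pair $(R,F)$ where $R$ is a subword (consecutive positions) of $\alpha$ consisting only of pushes and $F$ is a later subword consisting only of pops, such that the pops corresponding to pushes of $R$ are exactly the pops of $F$ and the pushes corresponding to pops of $F$ are exactly the pushes of $R$ (so $R$ and $F$ have the same total size), and which is minimal: no pair $(R',F')$ with the same properties has $R'$ a proper nonempty subword of $R$ and $F'$ a subword of $F$.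 Two operation sequences are rise-fall related if one is obtained from the other by replacing, for one rise-fall subsequence $(R,F)$, the subword $R$ by some word of pushes and the subword $F$ by some word of pops (leaving all other operations unchanged), in such a way that the produced permutation does not change. *)

(* Defs.v *)
From mathcomp Require Import all_boot.
Set Implicit Arguments. Unset Strict Implicit. Unset Printing Implicit Defensive.

Inductive op := Push of nat | Pop of nat.

Definition is_push (o : op) : bool := if o is Push _ then true else false.
Definition is_pop (o : op) : bool := if o is Pop _ then true else false.
Definition op_size (o : op) : nat := match o with Push a => a | Pop b => b end.

Definition push_total (w : seq op) : nat :=
  sumn [seq op_size o | o <- w & is_push o].
Definition pop_total (w : seq op) : nat :=
  sumn [seq op_size o | o <- w & is_pop o].

Definition well_formed (w : seq op) : Prop :=
  all (fun o => 0 < op_size o) w /\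
  (forall k, k <= size w -> pop_total (take k w) <= push_total (take k w)) /\
  push_total w = pop_total w.

Definition op_seq_size (w : seq op) : nat := push_total w.

(* state: (input stack, working stack, output stack), tops first *)
Definition state := (seq nat * seq nat * seq nat)%type.

(* one step; also returns the support (block moved) *)
Definition step (s : state) (o : op) : state * seq nat :=
  let: (inp, wk, out) := s in
  match o with
  | Push a => ((drop a inp, take a inp ++ wk, out), take a inp)
  | Pop b => ((inp, drop b wk, take b wk ++ out), take b wk)
  end.

Definition init_state (w : seq op) : state := (iota 1 (op_seq_size w), [::], [::]).

Definition run_from (s : state) (u : seq op) : state :=
  foldl (fun s o => (step s o).1) s u.

Definition state_at (w : seq op) (i : nat) : state :=
  run_from (init_state w) (take i w).

(* the permutation produced: final output stack, top to bottom *)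
Definition produced_perm (w : seq op) : seq nat :=
  (run_from (init_state w) w).2.

Definition equivalent (w1 w2 : seq op) : Prop :=
  op_seq_size w1 = op_seq_size w2 /\ produced_perm w1 = produced_perm w2.

Definition reduced (w : seq op) : Prop :=
  forall i, i.+1 < size w -> is_push (nth (Pop 0) w i) -> is_pop (nth (Pop 0) w i.+1) ->
    nth (Pop 0) w i = Push 1 /\ nth (Pop 0) w i.+1 = Pop 1.

Definition support (w : seq op) (i : nat) : seq nat :=
  (step (state_at w i) (nth (Pop 0) w i)).2.

Definition op_at (w : seq op) (i : nat) : op := nth (Pop 0) w i.

Definition corresponds (w : seq op) (q p : nat) : Prop :=
  [/\ q < size w, p < size w, is_push (op_at w q), is_pop (op_at w p) &
      has (fun x => x \in support w p) (support w q)].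

(* (R, F) with R = positions [i, i+k), F = positions [j, j+l), satisfying all
   requirements of a rise-fall subsequence except minimality *)
Definition rf_cond (w : seq op) (i k j l : nat) : Prop :=
  [/\ 0 < k, 0 < l, i + k <= j & j + l <= size w] /\
  (forall q, i <= q < i + k -> is_push (op_at w q)) /\
  (forall p, j <= p < j + l -> is_pop (op_at w p)) /\
  (forall p, p < size w -> is_pop (op_at w p) ->
      ((exists2 q, i <= q < i + k & corresponds w q p) <-> j <= p < j + l)) /\
  (forall q, q < size w -> is_push (op_at w q) ->
      ((exists2 p, j <= p < j + l & corresponds w q p) <-> i <= q < i + k)).

Definition rise_fall (w : seq op) (i k j l : nat) : Prop :=
  rf_cond w i k j l /\
  ~ (exists i' k' j' l',
        [/\ rf_cond w i' k' j' l',
            0 < k', k' < k, i <= i' & i' + k' <= i + k] /\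
        (j <= j' /\ j' + l' <= j + l)).

Definition rf_step (w1 w2 : seq op) : Prop :=
  well_formed w1 /\ well_formed w2 /\
  exists i k j l (R' F' : seq op),
    [/\ rise_fall w1 i k j l, all is_push R', all is_pop F',
        w2 = take i w1 ++ R' ++ take (j - (i + k)) (drop (i + k) w1) ++ F'
               ++ drop (j + l) w1 &
        produced_perm w2 = produced_perm w1].

Definition rf_related (w1 w2 : seq op) : Prop := rf_step w1 w2 \/ rf_step w2 w1.

(* chain gamma_0 = x, gamma_1, ..., gamma_r (the list gs = [gamma_1; ...; gamma_r]) *)
Fixpoint rf_chain (x : seq op) (gs : seq (seq op)) : Prop :=
  match gs with
  | [::] => True
  | y :: gs' => rf_related x y /\ rf_chain y gs'
  end.

(* Main.v *)
From mathcomp Require Import all_boot zify.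
Require Import Defs.
Set Implicit Arguments. Unset Strict Implicit. Unset Printing Implicit Defensive.

(** Each element is carried by one push and one pop. If [e < f] are on the
    working stack together, then [e] is output before [f] iff exactly one of
    "same push", "same pop" holds for them. A reduced sequence always pops the
    last pushed element first in a run of pops, so the number of elements pushed
    before each output is the running maximum of the outputs. Hence equivalent
    reduced sequences have the same runs, and for every pair of elements the
    exclusive or of "same push" and "same pop" agrees.

     Call an element moved if its push block differs in the two sequences. The
    components of moved elements under "same push or same pop" are intervals in
    both input and output order inside one push run and one pop run, i.e.
    minimal rise-fall subsequences. If the components of a moved element in the
    two sequences coincide, one is replaced by the other. Otherwise one that is
    not contained in the other is a single push matched with a single pop of the
    same size, and is replaced by unit operations. Taking the shorter side as
    the one to be replaced, this terminates: the total number of operations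
    never decreases, and when it stays the same the common prefix of the two
    sequences grows. *)

(** * Cumulative push and pop sizes of prefixes *)

Definition pt (w : seq op) i := push_total (take i w).
Definition qt (w : seq op) i := pop_total (take i w).

Lemma push_total_cat u v : push_total (u ++ v) = push_total u + push_total v.
Proof. by rewrite /push_total filter_cat map_cat sumn_cat. Qed.

Lemma pop_total_cat u v : pop_total (u ++ v) = pop_total u + pop_total v.
Proof. by rewrite /pop_total filter_cat map_cat sumn_cat. Qed.

Lemma push_total_cons o u :
  push_total (o :: u) = (if o is Push a then a else 0) + push_total u.
Proof. by case: o. Qed.

Lemma pop_total_cons o u :
  pop_total (o :: u) = (if o is Pop a then a else 0) + pop_total u.
Proof. by case: o. Qed.

Lemma push_total_pops u : all is_pop u -> push_total u = 0.
Proof. by elim: u => [|[] a u IH] //= /IH. Qed.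

Lemma pop_total_pushes u : all is_push u -> pop_total u = 0.
Proof. by elim: u => [|[] a u IH] //= /IH. Qed.

Lemma take_op_at w i : i < size w -> take i.+1 w = take i w ++ [:: op_at w i].
Proof. by move=> ?; rewrite (take_nth (Pop 0)) // -cats1. Qed.

Lemma pt0 w : pt w 0 = 0. Proof. by rewrite /pt take0. Qed.
Lemma qt0 w : qt w 0 = 0. Proof. by rewrite /qt take0. Qed.

Lemma ptS w i : i < size w ->
  pt w i.+1 = pt w i + (if op_at w i is Push a then a else 0).
Proof. by move=> ?; rewrite /pt take_op_at // push_total_cat push_total_cons addn0. Qed.

Lemma qtS w i : i < size w ->
  qt w i.+1 = qt w i + (if op_at w i is Pop a then a else 0).
Proof. by move=> ?; rewrite /qt take_op_at // pop_total_cat pop_total_cons addn0. Qed.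

Lemma pt_mono w i j : i <= j -> pt w i <= pt w j.
Proof.
move=> le_ij; rewrite -(subnKC le_ij) /pt takeD push_total_cat; exact: leq_addr.
Qed.

Lemma qt_mono w i j : i <= j -> qt w i <= qt w j.
Proof.
move=> le_ij; rewrite -(subnKC le_ij) /qt takeD pop_total_cat; exact: leq_addr.
Qed.

Lemma pt_size w : pt w (size w) = op_seq_size w.
Proof. by rewrite /pt take_size. Qed.

Lemma pt_le w i : pt w i <= op_seq_size w.
Proof.
by rewrite -[w in op_seq_size w](cat_take_drop i) /op_seq_size push_total_cat leq_addr.
Qed.

Lemma index_memE (s : seq nat) e : (e \in s) = (index e s < size s).
Proof. by rewrite index_mem. Qed.

(** * Locating elements and outputs by cumulative sizes *)

Definition blk (c : nat -> nat) m v := find (fun i => v <= c i.+1) (iota 0 m).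

Lemma blkP c m v : c 0 = 0 -> 0 < v <= c m ->
  [/\ blk c m v < m, c (blk c m v) < v & v <= c (blk c m v).+1].
Proof.
move=> c0 /andP[v0 vm].
have m0 : 0 < m by case: m vm => //; rewrite c0; lia.
have hs : has (fun i => v <= c i.+1) (iota 0 m).
  by apply/hasP; exists m.-1; rewrite ?mem_iota ?prednK //; lia.
have lt : blk c m v < m by move: hs; rewrite has_find size_iota.
have := nth_find 0 hs; rewrite -/(blk c m v) nth_iota // add0n => ub; split=> //.
case E : (blk c m v) => [|i]; first by rewrite c0.
have := @before_find _ 0 (fun i => v <= c i.+1) (iota 0 m) i.
by rewrite -/(blk c m v) E ltnSn nth_iota ?add0n; [move=> /(_ isT); lia | lia].
Qed.

Lemma blk_eq c m v i : (forall i j, i <= j -> c i <= c j) ->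
  c 0 = 0 -> i < m -> c i < v <= c i.+1 -> blk c m v = i.
Proof.
move=> mono c0 im /andP[lo hi].
have vm : 0 < v <= c m by have := mono i.+1 m im; lia.
have [lt lo' hi'] := blkP c0 vm.
case: (ltngtP (blk c m v) i) => // h.
- by have := mono _ _ h; lia.
- by have := mono _ _ h; lia.
Qed.

(* the position of the operation pushing element [e], resp. performing the
   [t]-th unit of output; elements and output times count from 1 *)
Definition pb w e := blk (pt w) (size w) e.
Definition qb w t := blk (qt w) (size w) t.

(** Output time of [e], counted from 1. The produced permutation is read from the top of the output
    stack, so the entry of index 0 leaves last. *)
Definition tm w e := op_seq_size w - index e (produced_perm w).

(** * States along a run, and the run structure [qlist] *)

Definition inp_at w i := (state_at w i).1.1.
Definition wk_at w i := (state_at w i).1.2.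
Definition out_at w i := (state_at w i).2.

Lemma state_atS w i : i < size w ->
  state_at w i.+1 = (step (state_at w i) (op_at w i)).1.
Proof.
by move=> lt; rewrite /state_at /run_from take_op_at // foldl_cat.
Qed.

Lemma run_from_cat s u v : run_from s (u ++ v) = run_from (run_from s u) v.
Proof. by rewrite /run_from foldl_cat. Qed.

(** For each unit of output in turn, the number of elements pushed before it. How a run of pushes or
    of pops is cut into operations leaves no trace in this list, so it records the runs alone. *)
Fixpoint qlist acc (w : seq op) : seq nat :=
  match w with
  | [::] => [::]
  | Push a :: w' => qlist (acc + a) w'
  | Pop b :: w' => nseq b acc ++ qlist acc w'
  end.

Lemma qlist_cat acc u v : qlist acc (u ++ v) = qlist acc u ++ qlist (acc + push_total u) v.
Proof.
elim: u acc => [|[] a u IH] acc; rewrite ?addn0 //= push_total_cons IH ?addnA //.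
by rewrite -catA.
Qed.

Lemma size_qlist acc w : size (qlist acc w) = pop_total w.
Proof.
by elim: w acc => [|[] a w IH] acc //=; rewrite pop_total_cons ?size_cat ?size_nseq IH.
Qed.

Lemma qlist_pushes acc u : all is_push u -> qlist acc u = [::].
Proof. by elim: u acc => [|[] a u IH] acc //= /IH ->. Qed.

Lemma qlist_pops acc u : all is_pop u -> qlist acc u = nseq (pop_total u) acc.
Proof.
by elim: u acc => [|[] a u IH] acc //= /IH ->; rewrite pop_total_cons nseqD.
Qed.

(* the number of elements pushed before the [t]-th output *)
Definition npushed w t := nth 0 (qlist 0 w) t.-1.

Lemma npushedE w j t : j < size w -> qt w j < t <= qt w j.+1 -> npushed w t = pt w j.
Proof.
move=> lt; rewrite qtS // /npushed => ht.
rewrite -[in LHS](cat_take_drop j w) (drop_nth (Pop 0)) // -/(op_at w j).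
rewrite qlist_cat nth_cat size_qlist -/(qt w j) add0n -/(pt w j).
case: ifP => [|_]; first lia.
case: (op_at w j) ht => a ht /=; first lia.
by rewrite nth_cat size_nseq nth_nseq; case: ifP => [->//|]; lia.
Qed.

(** * Stack contents of a well-formed sequence *)

Section WellFormed.
Variable w : seq op.
Hypothesis wf : well_formed w.
Local Notation n := (op_seq_size w).
Local Notation pi := (produced_perm w).

Lemma wf_pos i : i < size w -> 0 < op_size (op_at w i).
Proof. by move=> lt; have /all_nthP := wf.1; apply. Qed.

Lemma qt_le_pt i : qt w i <= pt w i.
Proof.
have [le|/ltnW le] := leqP i (size w); first exact: wf.2.1.
by rewrite /pt /qt take_oversize // wf.2.2.
Qed.

Lemma qt_size : qt w (size w) = n.
Proof. by rewrite /qt take_size -wf.2.2. Qed.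

Lemma qt_le i : qt w i <= n.
Proof. exact: leq_trans (qt_le_pt i) (pt_le w i). Qed.

(** The four clauses hold together by induction along the word. The permutation clause later
    determines the working stack as the pushed elements that have not been output. *)
Lemma size_inp_wk_out i : i <= size w ->
  [/\ inp_at w i = iota (1 + pt w i) (n - pt w i),
      size (wk_at w i) = pt w i - qt w i,
      size (out_at w i) = qt w i &
      perm_eq (wk_at w i ++ out_at w i) (iota 1 (pt w i))].
Proof.
elim: i => [|i IH] lt.
  by rewrite /inp_at /wk_at /out_at /state_at take0 pt0 qt0 subn0.
have [] := IH (ltnW lt); rewrite /inp_at /wk_at /out_at state_atS //.
have := wf_pos lt; have := qt_le_pt i.+1; have := qt_le_pt i; have := pt_le w i.+1.
rewrite ptS // qtS //.
case: (state_at w i) => [[inp wk] out] /=; case: (op_at w i) => a /=.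
- move=> h1 h2 h3 h4 -> sw so pe.
  rewrite addn0 drop_iota take_iota; split.
  + by congr iota; lia.
  + by rewrite size_cat size_iota sw; lia.
  + by [].
  + have -> : minn a (n - pt w i) = a by lia.
    by rewrite iotaD -catA perm_catC perm_cat2r.
- move=> h1 h2 h3 h4 -> sw so pe; rewrite addn0; split=> //.
  + by rewrite size_drop sw; lia.
  + by rewrite size_cat size_take sw so; case: ltnP; lia.
  + by apply: perm_trans pe; rewrite catA perm_cat2r perm_catC cat_take_drop.
Qed.

Lemma run_from_out_suffix s u : exists A, (run_from s u).2 = A ++ s.2.
Proof.
elim: u s => [|o u IH] [[inp wk] out] /=; first by exists [::].
have [A ->] := IH (step (inp, wk, out) o).1.
by case: o => a /=; [exists A | exists (A ++ take a wk); rewrite catA].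
Qed.

Lemma state_at_size : state_at w (size w) = run_from (init_state w) w.
Proof. by rewrite /state_at take_size. Qed.

Lemma pi_perm : perm_eq pi (iota 1 n).
Proof.
have [_ sw _] := size_inp_wk_out (leqnn (size w)).
have -> : wk_at w (size w) = [::].
  by apply: size0nil; rewrite sw pt_size qt_size subnn.
by rewrite /out_at state_at_size pt_size.
Qed.

Lemma pi_uniq : uniq pi. Proof. by rewrite (perm_uniq pi_perm) iota_uniq. Qed.
Lemma pi_size : size pi = n. Proof. by rewrite (perm_size pi_perm) size_iota. Qed.
Lemma mem_pi e : (e \in pi) = (0 < e <= n).
Proof. by rewrite (perm_mem pi_perm) mem_iota; lia. Qed.

Lemma pi_out i : i <= size w -> exists A, pi = A ++ out_at w i.
Proof.
move=> le; have [A E] := run_from_out_suffix (state_at w i) (drop i w).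
by exists A; rewrite -E /state_at -run_from_cat cat_take_drop.
Qed.

Lemma tm_rng e : 0 < e <= n -> 0 < tm w e <= n.
Proof. by rewrite /tm -mem_pi index_memE pi_size; lia. Qed.

Lemma tm_inj e f : 0 < e <= n -> 0 < f <= n -> tm w e = tm w f -> e = f.
Proof.
rewrite -!mem_pi => he hf E.
have : index e pi = index f pi.
  by move: E he hf; rewrite /tm !index_memE pi_size; lia.
by move=> /(congr1 (nth 0 pi)); rewrite !nth_index.
Qed.

Lemma tm_surj t : 0 < t <= n -> exists2 e, 0 < e <= n & tm w e = t.
Proof.
move=> ht; exists (nth 0 pi (n - t)); first by rewrite -mem_pi mem_nth // pi_size; lia.
by rewrite /tm index_uniq ?pi_size ?pi_uniq //; lia.
Qed.

(** Later operations only add on top of the output stack, so at step [i] it is the suffix of [pi] of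
    length [qt w i], and membership is a comparison of indices. *)
Lemma mem_out i e : i <= size w -> 0 < e <= n -> (e \in out_at w i) = (tm w e <= qt w i).
Proof.
move=> le he; have [A E] := pi_out le; have [_ _ so _] := size_inp_wk_out le.
have := he; rewrite -mem_pi E mem_cat => hm.
have sA : size A + qt w i = n by rewrite -so -size_cat -E pi_size.
rewrite /tm E index_cat; have := pi_uniq; rewrite E cat_uniq => /and3P[_ /hasPn hn _].
case: ifP hm => [eA _|_ /= eo].
  have := eA; rewrite index_memE => h.
  have -> : (e \in out_at w i) = false by apply/negP => /hn; rewrite /= eA.
  by apply/esym/negbTE; rewrite -ltnNge; lia.
by rewrite eo; apply/esym; move: sA; lia.
Qed.

Lemma mem_wk i e : i <= size w ->
  (e \in wk_at w i) = [&& 0 < e, e <= pt w i & qt w i < tm w e].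
Proof.
move=> le; have [_ _ _ pe] := size_inp_wk_out le.
have := perm_mem pe e; rewrite mem_cat mem_iota.
have := perm_uniq pe; rewrite iota_uniq cat_uniq => /and3P[_ /hasPn hn _].
have [he|he] := boolP (0 < e <= pt w i); last first.
  by case: (e \in wk_at w i); rewrite //=; move: he; lia.
have he' : 0 < e <= n by have := pt_le w i; move: he; lia.
have := mem_out le he'.
case: (e \in wk_at w i) (hn e); case: (e \in out_at w i) => //= h1 h2 h3; 
  by [move: (h1 isT) | move: he h2 h3; lia].
Qed.

Lemma wk_uniq i : i <= size w -> uniq (wk_at w i).
Proof.
move=> le; have [_ _ _ pe] := size_inp_wk_out le.
by have := perm_uniq pe; rewrite iota_uniq cat_uniq => /and3P[].
Qed.

(** * Operations as intervals of elements and of output times *)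

Lemma pbP e : 0 < e <= n -> [/\ pb w e < size w, pt w (pb w e) < e & e <= pt w (pb w e).+1].
Proof. by move=> he; apply: blkP; rewrite ?pt0 ?pt_size. Qed.

Lemma qbP t : 0 < t <= n -> [/\ qb w t < size w, qt w (qb w t) < t & t <= qt w (qb w t).+1].
Proof. by move=> he; apply: blkP; rewrite ?qt0 ?qt_size. Qed.

Lemma pb_eq e i : i < size w -> pt w i < e <= pt w i.+1 -> pb w e = i.
Proof. by move=> lt h; apply: blk_eq; rewrite ?pt0 //; apply: pt_mono. Qed.

Lemma qb_eq t i : i < size w -> qt w i < t <= qt w i.+1 -> qb w t = i.
Proof. by move=> lt h; apply: blk_eq; rewrite ?qt0 //; apply: qt_mono. Qed.

(** With the three variants that follow, this turns comparisons of positions into comparisons with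
    cumulative sizes, hence into linear arithmetic. *)
Lemma pb_le e j : 0 < e <= n -> (pb w e <= j) = (e <= pt w j.+1).
Proof.
move=> he; have [lt lo hi] := pbP he; apply/idP/idP => h.
  exact: leq_trans hi (pt_mono _ _).
by rewrite leqNgt; apply/negP => /(pt_mono w); lia.
Qed.

Lemma qb_le t j : 0 < t <= n -> (qb w t <= j) = (t <= qt w j.+1).
Proof.
move=> he; have [lt lo hi] := qbP he; apply/idP/idP => h.
  exact: leq_trans hi (qt_mono _ _).
by rewrite leqNgt; apply/negP => /(qt_mono w); lia.
Qed.

Lemma pb_lt e j : 0 < e <= n -> (pb w e < j) = (e <= pt w j).
Proof. by case: j => [|j] he; [rewrite pt0; lia | rewrite ltnS pb_le]. Qed.

Lemma qb_lt t j : 0 < t <= n -> (qb w t < j) = (t <= qt w j).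
Proof. by case: j => [|j] he; [rewrite qt0; lia | rewrite ltnS qb_le]. Qed.

Lemma pb_mono e f : 0 < e <= n -> 0 < f <= n -> e <= f -> pb w e <= pb w f.
Proof. by move=> he hf le; rewrite pb_le //; have [_ _] := pbP hf; lia. Qed.

Lemma qb_mono t s : 0 < t <= n -> 0 < s <= n -> t <= s -> qb w t <= qb w s.
Proof. by move=> ht hs le; rewrite qb_le //; have [_ _] := qbP hs; lia. Qed.

Lemma pb_push e : 0 < e <= n -> is_push (op_at w (pb w e)).
Proof. by move=> /pbP[lt lo hi]; move: hi; rewrite ptS //; case: op_at => //=; lia. Qed.

Lemma qb_pop t : 0 < t <= n -> is_pop (op_at w (qb w t)).
Proof. by move=> /qbP[lt lo hi]; move: hi; rewrite qtS //; case: op_at => //=; lia. Qed.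

Lemma push_exists i : i < size w -> is_push (op_at w i) ->
  [/\ pt w i < pt w i.+1, qt w i.+1 = qt w i, 0 < (pt w i).+1 <= n & pb w (pt w i).+1 = i].
Proof.
move=> lt isp; have := wf_pos lt; have := pt_le w i.+1.
have := @pb_eq (pt w i).+1 i lt; rewrite ptS // qtS //.
by case: (op_at w i) isp => //= a _ h1 h2 h3; split; [lia | lia | lia | apply: h1; lia].
Qed.

Lemma pop_exists i : i < size w -> is_pop (op_at w i) ->
  [/\ qt w i < qt w i.+1, pt w i.+1 = pt w i, 0 < (qt w i).+1 <= n & qb w (qt w i).+1 = i].
Proof.
move=> lt isp; have := wf_pos lt; have := qt_le i.+1.
have := @qb_eq (qt w i).+1 i lt; rewrite ptS // qtS //.
by case: (op_at w i) isp => //= a _ h1 h2 h3; split; [lia | lia | lia | apply: h1; lia].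
Qed.

Lemma support_push i e : i < size w -> is_push (op_at w i) ->
  (e \in support w i) = (pt w i < e <= pt w i.+1).
Proof.
move=> lt; have [E _ _ _] := size_inp_wk_out (ltnW lt).
have := pt_le w i.+1; rewrite ptS // /support -/(op_at w i).
move: E; rewrite /inp_at; case: (state_at w i) => [[inp wk] out] /= ->.
by case: (op_at w i) => //= a h _; rewrite take_iota mem_iota; lia.
Qed.

Lemma support_pop i : i < size w -> is_pop (op_at w i) ->
  wk_at w i = support w i ++ wk_at w i.+1 /\ out_at w i.+1 = support w i ++ out_at w i.
Proof.
move=> lt; rewrite /support -/(op_at w i) /wk_at /out_at state_atS //.
by case: (state_at w i) => [[inp wk] out]; case: (op_at w i) => //= a _; rewrite cat_take_drop.
Qed.

Lemma mem_support_pop i e : i < size w -> is_pop (op_at w i) ->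
  (e \in support w i) = (0 < e <= n) && (qt w i < tm w e <= qt w i.+1).
Proof.
move=> lt isp; have [Ew Eo] := support_pop lt isp.
have := mem_wk e (ltnW lt); rewrite Ew mem_cat.
have := wk_uniq (ltnW lt); rewrite Ew cat_uniq => /and3P[_ /hasPn hn _].
have [_ Ept _ _] := pop_exists lt isp.
have := mem_wk e lt; have := pt_le w i; rewrite Ept.
have := hn e; have := qt_le_pt i.
have [he|he] := boolP (0 < e <= n); last first.
  by case: (e \in support w i) => //=; move: he; lia.
have hm1 := mem_out lt he.
have := hm1; rewrite Eo mem_cat (mem_out (ltnW lt)) //.
have := pb_le (pb w e) he; rewrite leqnn.
move: (e \in support w i) (e \in wk_at w i.+1) => [] [] //=; lia.
Qed.

Lemma wk_push i : i < size w -> is_push (op_at w i) ->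
  wk_at w i.+1 = support w i ++ wk_at w i /\ out_at w i.+1 = out_at w i.
Proof.
move=> lt; rewrite /support -/(op_at w i) /wk_at /out_at state_atS //.
by case: (state_at w i) => [[inp wk] out]; case: (op_at w i).
Qed.

Lemma support_push_iota i : i < size w -> is_push (op_at w i) ->
  support w i = iota (1 + pt w i) (pt w i.+1 - pt w i).
Proof.
move=> lt; have [E _ _ _] := size_inp_wk_out (ltnW lt).
have := pt_le w i.+1; rewrite ptS // /support -/(op_at w i).
move: E; rewrite /inp_at; case: (state_at w i) => [[inp wk] out] /= ->.
by case: (op_at w i) => //= a h _; rewrite take_iota; congr iota; lia.
Qed.

(** * The order on the working stack, seen from pushes and from pops *)

Definition above_push e f := (pb w f < pb w e) || (pb w e == pb w f) && (e < f).
(** A popped block keeps its order and the output stack is read from its top, so inside one pop the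
    higher element has the larger output time. *)
Definition above_pop e f :=
  (qb w (tm w e) < qb w (tm w f)) || (qb w (tm w e) == qb w (tm w f)) && (tm w f < tm w e).

Lemma pairwise_above_push i : i <= size w -> pairwise above_push (wk_at w i).
Proof.
elim: i => [|i IH] lt; first by rewrite /wk_at /state_at take0.
have {}IH := IH (ltnW lt).
case E : (is_push (op_at w i)).
  have [-> _] := wk_push lt E; rewrite pairwise_cat IH andbT; apply/andP; split.
    apply/allrelP => e f; rewrite support_push // mem_wk ?(ltnW lt) // => h1 h2.
    by apply/orP; left; rewrite (pb_eq lt h1) pb_lt; have := pt_le w i; lia.
  have h : pairwise ltn (support w i).
    rewrite support_push_iota // -sorted_pairwise ?iota_ltn_sorted //.
    exact: ltn_trans.
  apply: (sub_in_pairwise (P := mem (support w i))) h; last exact/allP.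
  move=> e f he hf; rewrite /= => h3.
  have h1 : pt w i < e <= pt w i.+1 by rewrite -support_push.
  have h2 : pt w i < f <= pt w i.+1 by rewrite -support_push.
  by rewrite /above_push (pb_eq lt h1) (pb_eq lt h2) eqxx h3 orbT.
have isp : is_pop (op_at w i) by move: E; case: op_at.
by have [E' _] := support_pop lt isp; move: IH; rewrite E' pairwise_cat => /and3P[].
Qed.

Lemma pairwise_index (s : seq nat) : uniq s -> pairwise (fun e f => index e s < index f s) s.
Proof.
move=> us; apply/(pairwiseP 0) => i j; rewrite !inE => hi hj lt.
by rewrite !index_uniq.
Qed.

(** Backward induction from the empty final working stack: undoing a pop puts its block back on top,
    and that block leaves before everything below it. *)
Lemma pairwise_above_pop i : i <= size w -> pairwise above_pop (wk_at w i).
Proof.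
move=> le; rewrite -(subKn le); elim: (size w - i) => [|k IH].
  have [_ sw _] := size_inp_wk_out (leqnn (size w)).
  by rewrite subn0 (size0nil (s := wk_at _ _)) // sw pt_size qt_size subnn.
have [h|h] := leqP (size w) k.
  by have -> : size w - k.+1 = size w - k by lia.
move: IH; have -> : size w - k = (size w - k.+1).+1 by lia.
have lt : size w - k.+1 < size w by lia.
move: (size w - k.+1) lt => j lt IH.
case E : (is_push (op_at w j)).
  by move: IH; have [-> _] := wk_push lt E; rewrite pairwise_cat => /and3P[].
have isp : is_pop (op_at w j) by move: E; case: op_at.
have [-> Eo] := support_pop lt isp; rewrite pairwise_cat IH andbT; apply/andP; split.
  apply/allrelP => e f; rewrite mem_support_pop // mem_wk // => /andP[he h1] h2.
  have hf : 0 < f <= n by have := pt_le w j.+1; lia.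
  by apply/orP; left; rewrite (qb_eq lt h1) ltnNge qb_le ?tm_rng //; lia.
have [A Epi] := pi_out lt.
have := pairwise_index pi_uniq; rewrite {3}Epi Eo !pairwise_cat.
move=> /and3P[_ _ /and3P[_ hp _]].
apply: (sub_in_pairwise (P := mem (support w j))) hp; last exact/allP.
move=> e f; rewrite -[e \in _]/(e \in support w j) -[f \in _]/(f \in support w j).
rewrite !mem_support_pop // => /andP[he h1] /andP[hf h2] h3.
rewrite /above_pop (qb_eq lt h1) (qb_eq lt h2) eqxx orbC /tm.
by have := he; have := hf; rewrite -!mem_pi !index_memE pi_size; lia.
Qed.

Definition samepush e f := pb w e == pb w f.
Definition samepop e f := qb w (tm w e) == qb w (tm w f).

Lemma pairwise_two (P Q : rel nat) s e f : pairwise P s -> pairwise Q s ->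
  e \in s -> f \in s -> e != f -> (P e f /\ Q e f) \/ (P f e /\ Q f e).
Proof.
elim: s => //= x s IH /andP[/allP Px Ps] /andP[/allP Qx Qs].
rewrite !inE => /orP[/eqP->|es] /orP[/eqP->|fs]; rewrite ?eqxx // => ne.
- by left; split; [apply: Px | apply: Qx].
- by right; split; [apply: Px | apply: Qx].
- exact: IH.
Qed.

(** As [e < f], [e] lies above [f] exactly when they share a push, and the upper of the two leaves
    first exactly when they do not share a pop. The two conditions combine to an exclusive or. *)
Lemma stack_order i (e f : nat) : i <= size w -> e \in wk_at w i -> f \in wk_at w i ->
  e < f -> (tm w e < tm w f) = samepush e f (+) samepop e f.
Proof.
move=> le he hf lt; have ne : e != f by lia.
have he' := he; have hf' := hf; rewrite !mem_wk // in he' hf'.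
have re : 0 < e <= n by have := pt_le w i; lia.
have rf : 0 < f <= n by have := pt_le w i; lia.
have [_ e1 e2] := qbP (tm_rng re); have [_ f1 f2] := qbP (tm_rng rf).
have m1 := @qt_mono w (qb w (tm w e)).+1 (qb w (tm w f)).
have m2 := @qt_mono w (qb w (tm w f)).+1 (qb w (tm w e)).
have := pairwise_two (pairwise_above_push le) (pairwise_above_pop le) he hf ne.
rewrite /above_push /above_pop /samepush /samepop.
have : pb w e <= pb w f by rewrite pb_le //; have [] := pbP rf; lia.
case: (ltngtP (pb w e) (pb w f)) => // _ _; case: (ltngtP (qb w (tm w e)) (qb w (tm w f))) => h /=;
  try (have := m1 h); try (have := m2 h); lia.
Qed.

(** * Push runs and pop runs *)

Lemma npushed_qb t : 0 < t <= n -> npushed w t = pt w (qb w t).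
Proof. by move=> /qbP[lt lo hi]; apply: npushedE => //; rewrite lo. Qed.

Lemma mem_wk_qb e : 0 < e <= n -> e \in wk_at w (qb w (tm w e)).
Proof.
move=> he; have [lt lo hi] := qbP (tm_rng he); have isp := qb_pop (tm_rng he).
have [-> _] := support_pop lt isp.
by rewrite mem_cat mem_support_pop // he lo hi.
Qed.

Lemma le_npushed e : 0 < e <= n -> e <= npushed w (tm w e).
Proof.
move=> he; rewrite npushed_qb ?tm_rng //; have := mem_wk_qb he.
by rewrite mem_wk; [lia | have [/ltnW] := qbP (tm_rng he)].
Qed.

Lemma pb_lt_qb e : 0 < e <= n -> pb w e < qb w (tm w e).
Proof. by move=> he; rewrite pb_lt // -npushed_qb ?tm_rng // le_npushed. Qed.

Lemma npushed_lt t e : 0 < t <= n -> 0 < e <= n -> (npushed w t < e) = (qb w t <= pb w e).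
Proof. by move=> ht he; rewrite npushed_qb // [qb w t <= _]leqNgt pb_lt // -ltnNge. Qed.

(** No output occurs between the pushes of [e] and [f]. Runs are phrased through [npushed] so that
    they transfer between sequences with the same [qlist] and the same output. *)
Definition pushrun e f := forall t, 0 < t <= n -> (npushed w t < e) = (npushed w t < f).
Definition poprun e f := npushed w (tm w e) = npushed w (tm w f).

Lemma samepush_run e f : 0 < e <= n -> 0 < f <= n -> samepush e f -> pushrun e f.
Proof. by move=> he hf /eqP E t ht; rewrite !npushed_lt // E. Qed.

Lemma samepop_run e f : 0 < e <= n -> 0 < f <= n -> samepop e f -> poprun e f.
Proof. by move=> he hf /eqP E; rewrite /poprun !npushed_qb ?tm_rng // E. Qed.

(** Right after the push of [f], the earlier [e] is still on the working stack: otherwise its output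
    would separate the two pushes. *)
Lemma pushrun_stack e f : 0 < e <= n -> 0 < f <= n -> e <= f -> pushrun e f ->
  exists i, [/\ i <= size w, e \in wk_at w i & f \in wk_at w i].
Proof.
move=> he hf le run; have [lt lo hi] := pbP hf; have isp := pb_push hf.
have [_ Eq _ _] := push_exists lt isp.
exists (pb w f).+1; split=> //; rewrite mem_wk // [qt w _ < _]ltnNge -qb_lt ?tm_rng //.
  have := run _ (tm_rng he); have := le_npushed he; rewrite (npushed_lt (tm_rng he) hf); lia.
by have := pb_lt_qb hf; lia.
Qed.

(** When the earlier of the two is popped, the other has already been pushed, since the number of
    pushed elements is constant within a pop run. *)
Lemma poprun_stack e f : 0 < e <= n -> 0 < f <= n -> poprun e f ->
  exists i, [/\ i <= size w, e \in wk_at w i & f \in wk_at w i].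
Proof.
wlog le : e f / tm w e <= tm w f.
  move=> H; case: (leqP (tm w e) (tm w f)) => [/H//|/ltnW/H{}H he hf run].
  by have [i [? ? ?]] := H hf he (esym run); exists i.
move=> he hf run; have [lt lo hi] := qbP (tm_rng he).
exists (qb w (tm w e)); split; [exact: ltnW | exact: mem_wk_qb |].
rewrite mem_wk; last exact: ltnW.
have := le_npushed hf; have := run; rewrite /poprun (npushed_qb (tm_rng he)); lia.
Qed.

Lemma run_order e f : 0 < e <= n -> 0 < f <= n -> pushrun e f \/ poprun e f ->
  e < f -> (tm w e < tm w f) = samepush e f (+) samepop e f.
Proof.
move=> he hf run lt.
have [i [le hei hfi]] : exists i, [/\ i <= size w, e \in wk_at w i & f \in wk_at w i].
  by case: run; [apply: pushrun_stack => //; exact: ltnW | apply: poprun_stack].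
exact: stack_order hei hfi lt.
Qed.

(** * Rise-fall conditions in terms of elements *)

Lemma correspondsP q p : corresponds w q p <->
  exists2 e, 0 < e <= n & pb w e = q /\ qb w (tm w e) = p.
Proof.
split=> [[ltq ltp isq isp /hasP[e]]|[e he [<- <-]]].
  rewrite support_push // mem_support_pop // => eq /andP[he ep].
  by exists e => //; split; [exact: pb_eq | exact: qb_eq].
have [lt1 lo1 hi1] := pbP he; have [lt2 lo2 hi2] := qbP (tm_rng he).
split=> //; [exact: pb_push | exact/qb_pop/tm_rng |].
apply/hasP; exists e; first by rewrite support_push ?pb_push // lo1 hi1.
by rewrite mem_support_pop ?qb_pop ?tm_rng // he lo2 hi2.
Qed.

(** A correspondence is witnessed by a single element, so only the sets of elements pushed in the
    rise and popped in the fall have to agree. The rise precedes the fall because an element popped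
    at [j] was pushed in the rise before [j], so [j < i + k] would make [j] a push. *)
Lemma rf_condI i k j l : 0 < k -> 0 < l -> i + k <= size w -> j + l <= size w ->
  (forall q, i <= q < i + k -> is_push (op_at w q)) ->
  (forall p, j <= p < j + l -> is_pop (op_at w p)) ->
  (forall e, 0 < e <= n -> (i <= pb w e < i + k) = (j <= qb w (tm w e) < j + l)) ->
  rf_cond w i k j l.
Proof.
move=> k0 l0 iks jls hR hF hK.
have pop_elt p : p < size w -> is_pop (op_at w p) ->
    exists2 e, 0 < e <= n & qb w (tm w e) = p.
  by move=> lt /(pop_exists lt)[_ _ ht E]; have [e he Et] := tm_surj ht; exists e; rewrite ?Et.
split; last split=> //; last split=> //; last split.
- split=> //; rewrite leqNgt; apply/negP => lt.
  have isp : is_pop (op_at w j) by apply: hF; lia.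
  have [e he Ee] := pop_elt j ltac:(lia) isp.
  have := hK e he; have := pb_lt_qb he; rewrite Ee => h1 h2.
  have : is_push (op_at w j) by apply: hR; lia.
  by move: isp; case: op_at.
- move=> p lt isp; split=> [[q hq /correspondsP[e he [Eq <-]]]|hp].
    by rewrite -hK // Eq.
  have [e he Ee] := pop_elt p lt isp; exists (pb w e); first by rewrite hK // Ee.
  by apply/correspondsP; exists e.
- move=> q lt isp; split=> [[p hp /correspondsP[e he [<- Ep]]]|hq].
    by rewrite hK // Ep.
  have [_ _ he Ee] := push_exists lt isp; exists (qb w (tm w (pt w q).+1)).
    by rewrite -hK // Ee.
  by apply/correspondsP; exists (pt w q).+1.
Qed.

Lemma rf_condE i k j l : rf_cond w i k j l -> forall e, 0 < e <= n ->
  (i <= pb w e < i + k) = (j <= qb w (tm w e) < j + l).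
Proof.
move=> [_ [_ [_ [hp hq]]]] e he.
have [lt1 _ _] := pbP he; have [lt2 _ _] := qbP (tm_rng he).
have c : corresponds w (pb w e) (qb w (tm w e)) by apply/correspondsP; exists e.
apply/idP/idP => h.
  by apply/hp => //; [exact/qb_pop/tm_rng | exists (pb w e)].
by apply/hq => //; [exact/pb_push | exists (qb w (tm w e))].
Qed.

(** * Linked components are rise-fall subsequences *)

Definition linked e f := samepush e f || samepop e f.

Section Component.
Variables (e0 : nat) (K : pred nat).
Hypothesis Ke0 : K e0.
Hypothesis K_rng : forall u, K u -> 0 < u <= n.
Hypothesis K_closed : forall u v, K u -> 0 < v <= n -> linked u v -> K v.
(** Connectedness as an induction principle: a property of [e0] that passes along links inside [K]
    holds on all of [K]. *)
Hypothesis K_min : forall C : nat -> Prop, C e0 ->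
  (forall u v, K u -> K v -> C u -> linked u v -> C v) -> forall v, K v -> C v.
Hypothesis K_run : forall u, K u -> pushrun e0 u /\ poprun e0 u.

Lemma K_pushrun u v : K u -> K v -> pushrun u v.
Proof. by move=> /K_run[hu _] /K_run[hv _] t ht; rewrite -hu // hv. Qed.

Lemma K_poprun u v : K u -> K v -> poprun u v.
Proof. by move=> /K_run[_ hu] /K_run[_ hv]; rewrite /poprun -hu. Qed.

Lemma linked_sym u v : linked u v = linked v u.
Proof. by rewrite /linked; congr (_ || _); exact: eq_sym. Qed.

Lemma pushrun_between u g v : pushrun u v -> u <= g <= v -> pushrun u g.
Proof. by move=> run h t ht; have := run t ht; lia. Qed.

(* a link jumping over an outside element [g] would have to come from a pop
   block, but then [g] lies between the two ends in the working stack *)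
Lemma K_nojump u g v : K u -> K v -> ~~ K g -> u < g < v -> ~~ linked u v.
Proof.
move=> Ku Kv nKg /andP[ug gv]; apply/negP => lk.
have ru := K_rng Ku; have rv := K_rng Kv; have rg : 0 < g <= n by lia.
have ng1 : ~~ linked u g by apply: contra nKg; exact: K_closed.
have ng2 : ~~ linked g v by apply: contra nKg; rewrite linked_sym; exact: K_closed.
have run := K_pushrun Ku Kv.
have rug : pushrun u g by apply: pushrun_between run _; rewrite (ltnW ug) ltnW.
have rgv : pushrun g v by move=> t ht; rewrite -rug // run.
have p1 := pb_mono ru rg (ltnW ug); have p2 := pb_mono rg rv (ltnW gv).
move: lk ng1 ng2; rewrite /linked !negb_or => lk /andP[s1 t1] /andP[s2 t2].
(* Unlinked elements of one run leave in decreasing order. So both the push and the pop of [g] lie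
   between those of [u] and [v], and a common push or pop would contain [g]. *)
have := run_order ru rg (or_introl rug) ug.
rewrite (negbTE s1) (negbTE t1) ltnNge => /negbFE /(qb_mono (tm_rng rg) (tm_rng ru)) q1.
have := run_order rg rv (or_introl rgv) gv.
rewrite (negbTE s2) (negbTE t2) ltnNge => /negbFE /(qb_mono (tm_rng rv) (tm_rng rg)) q2.
move: s1 t1; case/orP: lk => /eqP E.
  by move: p1 p2; rewrite /samepush -E => p1 p2; rewrite eqn_leq p1 p2.
by move: q1 q2; rewrite /samepop -E => q1 q2; rewrite [qb w _ == _]eqn_leq q1 q2.
Qed.

(** A shared pop of [u] and [v] would contain [g], so a link would be a shared push with different
    pops, which forces [u <= v]. Unlinked elements of one pop run leave in decreasing order, which
    gives [v <= g <= u]. Then [u = v], against their output times. *)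
Lemma K_nojump_tm u g v : K u -> K v -> ~~ K g -> 0 < g <= n ->
  tm w u < tm w g < tm w v -> ~~ linked u v.
Proof.
move=> Ku Kv nKg rg /andP[h1 h2]; apply/negP => lk.
have ru := K_rng Ku; have rv := K_rng Kv.
have ng1 : ~~ linked u g by apply: contra nKg; exact: K_closed.
have ng2 : ~~ linked g v by apply: contra nKg; rewrite linked_sym; exact: K_closed.
have run := K_poprun Ku Kv.
have q1 := qb_mono (tm_rng ru) (tm_rng rg) (ltnW h1).
have q2 := qb_mono (tm_rng rg) (tm_rng rv) (ltnW h2).
have rug : poprun u g.
  move: run (pt_mono w q1) (pt_mono w q2); rewrite /poprun !npushed_qb ?tm_rng //.
  by move=> -> le1 le2; apply/eqP; rewrite eqn_leq le1 le2.
have rgv : poprun g v by rewrite /poprun -rug.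
move: lk ng1 ng2; rewrite /linked !negb_or => lk /andP[s1 t1] /andP[s2 t2].
have nt : ~~ samepop v u.
  apply: contra t1 => /eqP E; move: q1 q2; rewrite /samepop E => q1 q2.
  by rewrite eqn_leq q1 q2.
have su : samepush v u by move: lk; rewrite -/(linked u v) linked_sym /linked (negbTE nt) orbF.
have lt_uv : u <= v.
  rewrite leqNgt; apply/negP => lt.
  have := run_order rv ru (or_intror (esym run)) lt.
  by rewrite su (negbTE nt) ltnNge (ltnW (ltn_trans h1 h2)).
have lt_gu : g <= u.
  rewrite leqNgt; apply/negP => lt.
  by have := run_order ru rg (or_intror rug) lt; rewrite (negbTE s1) (negbTE t1) h1.
have lt_vg : v <= g.
  rewrite leqNgt; apply/negP => lt.
  by have := run_order rg rv (or_intror rgv) lt; rewrite (negbTE s2) (negbTE t2) h2.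
have E : u = v by apply/eqP; rewrite eqn_leq lt_uv (leq_trans lt_vg).
by move: (ltn_trans h1 h2); rewrite E ltnn.
Qed.

(** If [g] were outside [K], no link could cross it, and connectedness would keep all of [K] on the
    side of [e0]; but [u] and [v] lie on different sides. *)
Lemma K_interval u g v : K u -> K v -> u <= g <= v -> K g.
Proof.
move=> Ku Kv h; apply/negPn/negP => nKg.
have ne z : K z -> z != g by apply: contraTneq => ->.
have /orP[lt|lt] : (e0 < g) || (g < e0) by have := ne _ Ke0; lia.
- have : v < g; last lia.
  apply: (K_min (C := fun z => z < g)) Kv => // a b Ka Kb lta lk.
  have := ne b Kb; case: (ltngtP b g) => // ltb _.
  by have := K_nojump Ka Kb nKg; rewrite lk lta ltb => /(_ isT).
- have : g < u; last lia.
  apply: (K_min (C := fun z => g < z)) Ku => // a b Ka Kb lta lk.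
  have := ne b Kb; case: (ltngtP b g) => // ltb _.
  by have := K_nojump Kb Ka nKg; rewrite linked_sym lk lta ltb => /(_ isT).
Qed.

Lemma K_interval_tm u g v : K u -> K v -> 0 < g <= n -> tm w u <= tm w g <= tm w v -> K g.
Proof.
move=> Ku Kv rg h; apply/negPn/negP => nKg.
have ne z : K z -> tm w z != tm w g.
  move=> Kz; apply/negP => /eqP /tm_inj E; move: nKg; rewrite -E ?Kz //.
  exact: K_rng.
have /orP[lt|lt] : (tm w e0 < tm w g) || (tm w g < tm w e0) by have := ne _ Ke0; lia.
- have : tm w v < tm w g; last lia.
  apply: (K_min (C := fun z => tm w z < tm w g)) Kv => // a b Ka Kb lta lk.
  have := ne b Kb; case: (ltngtP (tm w b) (tm w g)) => // ltb _.
  by have := K_nojump_tm Ka Kb nKg rg; rewrite lk lta ltb => /(_ isT).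
- have : tm w g < tm w u; last lia.
  apply: (K_min (C := fun z => tm w g < tm w z)) Ku => // a b Ka Kb lta lk.
  have := ne b Kb; case: (ltngtP (tm w b) (tm w g)) => // ltb _.
  by have := K_nojump_tm Kb Ka nKg rg; rewrite linked_sym lk lta ltb => /(_ isT).
Qed.

(** The rise spans the push positions of the least and greatest elements of [K], the fall the pop
    positions of its earliest and latest outputs. A smaller pair inside would give a set of elements
    closed under links, hence all of [K]. *)
Lemma component_rise_fall : exists i k j l, rise_fall w i k j l /\
  forall e, 0 < e <= n -> K e = (i <= pb w e < i + k).
Proof.
have exK : exists e, K e by exists e0.
have ubK e : K e -> e <= n by move=> /K_rng; lia.
case: (ex_minnP exK) => a Ka amin; case: (ex_maxnP exK ubK) => b Kb bmax.
(* The image of [K] under [tm] as a boolean predicate, so that its least and greatest members can be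
   taken. *)
pose Kt t := has (fun e => K e && (tm w e == t)) (iota 1 n).
have KtP t : reflect (exists2 e, K e & tm w e = t) (Kt t).
  apply: (iffP hasP) => [[e _ /andP[Ke /eqP]]|[e Ke <-]]; first by exists e.
  by exists e; rewrite ?Ke ?eqxx // mem_iota; have := K_rng Ke; lia.
have exT : exists t, Kt t by exists (tm w e0); apply/KtP; exists e0.
have ubT t : Kt t -> t <= n.
  by move=> /KtP[e Ke <-]; have := tm_rng (K_rng Ke); lia.
case: (ex_minnP exT) => _ /KtP[c Kc <-] cmin; case: (ex_maxnP exT ubT) => _ /KtP[d Kd <-] dmax.
have {}cmin e : K e -> tm w c <= tm w e by move=> Ke; apply: cmin; apply/KtP; exists e.
have {}dmax e : K e -> tm w e <= tm w d by move=> Ke; apply: dmax; apply/KtP; exists e.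
have [ra rb rc rd] : [/\ 0 < a <= n, 0 < b <= n, 0 < c <= n & 0 < d <= n].
  by split; apply: K_rng.
have tc := tm_rng rc; have td := tm_rng rd.
have [lb _ _] := pbP rb; have [ld _ _] := qbP td.
have ab := pb_mono ra rb (amin _ Kb); have cd := qb_mono tc td (cmin _ Kd).
have KE e : 0 < e <= n -> K e = (pb w a <= pb w e < pb w a + (pb w b - pb w a).+1).
  move=> he; apply/idP/idP => [Ke|h].
    have := pb_mono ra he (amin _ Ke); have := pb_mono he rb (bmax _ Ke); lia.
  (* An element below [a] whose push is not earlier than that of [a] belongs to the same push;
     likewise for an element above [b]. *)
  case: (ltnP e a) => [/ltnW lt|le1].
    have E := pb_mono he ra lt; apply: (K_closed Ka) => //.
    by apply/orP; left; rewrite /samepush; lia.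
  case: (ltnP b e) => [/ltnW lt|le2]; last by apply: (K_interval Ka Kb); rewrite le1.
  have E := pb_mono rb he lt; apply: (K_closed Kb) => //.
  by apply/orP; left; rewrite /samepush; lia.
have KtE e : 0 < e <= n ->
    K e = (qb w (tm w c) <= qb w (tm w e) < qb w (tm w c) + (qb w (tm w d) - qb w (tm w c)).+1).
  move=> he; have te := tm_rng he; apply/idP/idP => [Ke|h].
    have := qb_mono tc te (cmin _ Ke); have := qb_mono te td (dmax _ Ke); lia.
  case: (ltnP (tm w e) (tm w c)) => [/ltnW lt|le1].
    have E := qb_mono te tc lt; apply: (K_closed Kc) => //.
    by apply/orP; right; rewrite /samepop; lia.
  case: (ltnP (tm w d) (tm w e)) => [/ltnW lt|le2]; last first.
    by apply: (K_interval_tm Kc Kd) => //; rewrite le1.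
  have E := qb_mono td te lt; apply: (K_closed Kd) => //.
  by apply/orP; right; rewrite /samepop; lia.
exists (pb w a), (pb w b - pb w a).+1, (qb w (tm w c)), (qb w (tm w d) - qb w (tm w c)).+1.
split=> //; split.
  apply: rf_condI => //; try lia.
  (* A pop between the pushes of [a] and [b] would produce an output separating them, although they
     lie in one push run. *)
  - move=> q hq; apply/negPn/negP => np.
    have isp : is_pop (op_at w q) by move: np; case: op_at.
    have [|_ _ ht E] := pop_exists _ isp; first by lia.
    have := K_pushrun Ka Kb ht; rewrite !npushed_lt // E.
    have : q != pb w a by apply: contraNneq np => ->; exact: pb_push.
    lia.
  - move=> p hp; apply/negPn/negP => np.
    have isp : is_push (op_at w p) by move: np; case: op_at.
    have [|_ _ hg E] := push_exists _ isp; first by lia.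
    have := npushed_lt tc hg; rewrite (K_poprun Kc Kd) npushed_lt // E.
    have : p != qb w (tm w d) by apply: contraNneq np => ->; exact/qb_pop/tm_rng.
    lia.
  - by move=> e he; rewrite -KE // -KtE.
move=> [i [k [j [l [[rf k0 lt_k lo hi] _]]]]].
have rfE := rf_condE rf.
have [[_ _ _ _] [hR _]] := rf.
have lt_i : i < size w by lia.
have [_ _ rg Eg] := push_exists lt_i (hR i ltac:(lia)).
set g := (pt w i).+1 in rg Eg.
have Kg : K g by rewrite KE // Eg; lia.
pose C z := i <= pb w z < i + k.
have stepC u v : K u -> K v -> C u -> linked u v -> C v.
  move=> /K_rng hu /K_rng hv Cu /orP[/eqP E|/eqP E]; first by rewrite /C -E.
  by rewrite /C rfE // -E -rfE.
(* Otherwise the complement of [C] would contain [e0] and pass along links, hence contain [g], which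
   is pushed at [i]. *)
have Ce0 : C e0.
  apply/negPn/negP => nC.
  have : ~ C g.
    apply: (K_min (C := fun z => ~ C z)) Kg; first exact/negP.
    by move=> u v Ku Kv nCu lk Cv; apply/nCu/(stepC v u) => //; rewrite linked_sym.
  by apply; rewrite /C Eg; lia.
have Ca := K_min Ce0 stepC Ka; have Cb := K_min Ce0 stepC Kb.
by move: Ca Cb; rewrite /C; lia.
Qed.

End Component.

End WellFormed.

(** * Well-formedness relative to a starting height *)

Fixpoint okh h (w : seq op) : bool :=
  match w with
  | [::] => true
  | Push a :: w' => (0 < a) && okh (h + a) w'
  | Pop b :: w' => [&& 0 < b, b <= h & okh (h - b) w']
  end.

(** Starting at height [h] and not asking for balanced totals makes the condition split over
    concatenation, so that parts of a word can be exchanged. *)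
Lemma okhP h w : reflect (all (fun o => 0 < op_size o) w /\
    forall k, k <= size w -> pop_total (take k w) <= h + push_total (take k w))
  (okh h w).
Proof.
elim: w h => [|o w IH] h /=; first by apply: ReflectT; split=> // [[]].
case: o => a /=.
- apply: (iffP andP) => [[a0 /IH[pos le]]|[/andP[a0 pos] le]].
    rewrite a0; split=> // [[|k]] //= lt.
    by have := le k lt; rewrite push_total_cons pop_total_cons; lia.
  split=> //; apply/IH; split=> // k lt.
  by have := le k.+1 lt; rewrite /= push_total_cons pop_total_cons; lia.
- apply: (iffP and3P) => [[a0 ah /IH[pos le]]|[/andP[a0 pos] le]].
    rewrite a0; split=> // [[|k]] //= lt.
    by have := le k lt; rewrite push_total_cons pop_total_cons; lia.
  have ah : a <= h by have := le 1 isT; rewrite /= take0 /pop_total /push_total /=; lia.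
  split=> //; apply/IH; split=> // k lt.
  by have := le k.+1 lt; rewrite /= push_total_cons pop_total_cons; lia.
Qed.

Lemma okh_cat h u v : okh h (u ++ v) = okh h u && okh (h + push_total u - pop_total u) v.
Proof.
elim: u h => [|[] a u IH] h /=; first by rewrite addn0 subn0.
  by rewrite IH push_total_cons pop_total_cons -andbA addnA.
rewrite IH push_total_cons pop_total_cons -!andbA; case: (leqP a h) => [le|]; last by rewrite !andbF.
by have -> : h - a + push_total u - pop_total u = h + (0 + push_total u) - (a + pop_total u) by lia.
Qed.

Lemma okh_pushes h u : all is_push u -> all (fun o => 0 < op_size o) u -> okh h u.
Proof. by elim: u h => [|[] a u IH] h //= isp /andP[-> pos]; exact: IH. Qed.

Lemma okh_pops h u : all is_pop u -> all (fun o => 0 < op_size o) u ->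
  pop_total u <= h -> okh h u.
Proof.
elim: u h => [|[] a u IH] h //= isp /andP[-> pos]; rewrite pop_total_cons /= => le.
by rewrite IH //; lia.
Qed.

(** * Running a rise, a middle part and a fall *)

Lemma drop_catl (T : Type) m (s t : seq T) : m <= size s -> drop m (s ++ t) = drop m s ++ t.
Proof.
by rewrite drop_cat; case: ltngtP => // -> _; rewrite subnn drop0 drop_size.
Qed.

(** The arrangement [A] is chosen before the context: pushes rearrange [X] independently of the rest
    of the state. *)
Lemma run_pushes X R : all is_push R -> push_total R = size X ->
  exists2 A, size A = size X &
  forall inp wk out, run_from (X ++ inp, wk, out) R = (inp, A ++ wk, out).
Proof.
(* The induction carries [Y], the part of the block already on the working stack. *)
move=> isp; suff : forall Y, push_total R = size X -> exists2 A, size A = size Y + size X &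
    forall inp wk out, run_from (X ++ inp, Y ++ wk, out) R = (inp, A ++ wk, out).
  by move=> /(_ [::]).
elim: R X isp => [|[] a R IH] X //= isp Y.
  by move=> /esym/size0nil ->; exists Y; rewrite ?addn0.
rewrite push_total_cons => E.
have [|A sA H] := IH (drop a X) isp (take a X ++ Y); first by rewrite size_drop; lia.
exists A; first by rewrite sA size_cat addnAC size_take size_drop; case: ltnP; lia.
move=> inp' wk' out'; have aX : a <= size X by lia.
by rewrite -H -catA /run_from /= takel_cat // drop_catl.
Qed.

Lemma run_pops A F : all is_pop F -> pop_total F = size A ->
  exists2 E, size E = size A &
  forall inp wk out, run_from (inp, A ++ wk, out) F = (inp, wk, E ++ out).
Proof.
move=> isp; suff : forall Y, pop_total F = size A -> exists2 E, size E = size Y + size A &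
    forall inp wk out, run_from (inp, A ++ wk, Y ++ out) F = (inp, wk, E ++ out).
  by move=> /(_ [::]).
elim: F A isp => [|[] a F IH] A //= isp Y.
  by move=> /esym/size0nil ->; exists Y; rewrite ?addn0.
rewrite pop_total_cons => E.
have [|B sB H] := IH (drop a A) isp (take a A ++ Y); first by rewrite size_drop; lia.
exists B; first by rewrite sB size_cat addnAC size_take size_drop; case: ltnP; lia.
move=> inp' wk' out'; have aA : a <= size A by lia.
by rewrite -H -catA /run_from /= takel_cat // drop_catl.
Qed.

(** A word that never pops deeper than [V] leaves what lies below untouched, and its result is
    uniform in that part [Z]. *)
Lemma run_above M inp V out : okh (size V) M -> push_total M <= size inp ->
  exists inp' V' out', size V' = size V + push_total M - pop_total M /\
  forall Z, run_from (inp, V ++ Z, out) M = (inp', V' ++ Z, out').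
Proof.
elim: M inp V out => [|[] a M IH] inp V out /=.
- by exists inp, V, out; rewrite addn0 subn0.
- rewrite push_total_cons pop_total_cons => /andP[a0 ok] le.
  have st : size (take a inp) = a by rewrite size_takel //; lia.
  have [||i' [V' [o' [sV H]]]] := IH (drop a inp) (take a inp ++ V) out.
  + by rewrite size_cat st addnC.
  + by rewrite size_drop; lia.
  exists i', V', o'; rewrite sV size_cat st; split; first lia.
  by move=> Z'; rewrite -H catA.
- rewrite push_total_cons pop_total_cons => /and3P[a0 aV ok] le.
  have [||i' [V' [o' [sV H]]]] := IH inp (drop a V) (take a V ++ out) => //.
  + by rewrite size_drop.
  exists i', V', o'; rewrite sV size_drop; split; first lia.
  by move=> Z'; rewrite -H /run_from /= takel_cat // drop_catl.
Qed.

Definition eff X R F := (run_from (X, [::], [::]) (R ++ F)).2.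

(** The balanced word [M] leaves the working stack as it was, so the fall pops exactly what the rise
    pushed. As [inp'] and [out'] are fixed before [R] and [F], two choices of rise and fall differ
    only through [eff]. *)
Lemma run_rise_fall inp out M : okh 0 M -> push_total M = pop_total M ->
  push_total M <= size inp -> exists inp' out', forall X wk R F,
  all is_push R -> all is_pop F -> push_total R = size X -> pop_total F = size X ->
  run_from (X ++ inp, wk, out) (R ++ M ++ F) = (inp', wk, eff X R F ++ out').
Proof.
move=> ok E le; have [inp' [V' [out' [sV H]]]] := @run_above M inp [::] out ok le.
have {}sV : V' = [::] by apply: size0nil; rewrite sV E /=; lia.
exists inp', out' => X wk R F hR hF tR tF.
have [A sA HA] := run_pushes hR tR.
rewrite -sA in tF; have [B sB HB] := run_pops hF tF.
have E1 : run_from (X, [::], [::]) R = ([::], A, [::]).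
  by have := HA [::] [::] [::]; rewrite !cats0.
have E2 : eff X R F = B.
  by rewrite /eff run_from_cat E1; have := HB [::] [::] [::]; rewrite !cats0 => ->.
have E3 : run_from (X ++ inp, wk, out) (R ++ M) = (inp', A ++ wk, out').
  by rewrite run_from_cat HA; have := H (A ++ wk); rewrite sV.
by rewrite E2 catA run_from_cat E3 HB.
Qed.

(** * A rise-fall subsequence inside its word *)

Lemma pt_take_drop w i k : push_total (take k (drop i w)) = pt w (i + k) - pt w i.
Proof. by rewrite /pt takeD push_total_cat; lia. Qed.

Lemma qt_take_drop w i k : pop_total (take k (drop i w)) = qt w (i + k) - qt w i.
Proof. by rewrite /qt takeD pop_total_cat; lia. Qed.

Section Frame.
Variable w : seq op.
Hypothesis wf : well_formed w.
Local Notation n := (op_seq_size w).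
Local Notation pi := (produced_perm w).
Variables i k j l : nat.
Hypothesis rf : rf_cond w i k j l.
Let R := take k (drop i w).
Let M := take (j - (i + k)) (drop (i + k) w).
Let F := take l (drop j w).
Let N := pt w (i + k) - pt w i.
Let X := iota (1 + pt w i) N.

Lemma frame_bounds : [/\ 0 < k, 0 < l, i + k <= j & j + l <= size w].
Proof. by case: rf. Qed.

Lemma frame_pushes : all is_push R.
Proof.
have [_ [hR _]] := rf; have [k0 l0 le1 le2] := frame_bounds.
apply/(all_nthP (Pop 0)) => q; rewrite size_takel ?size_drop => [lt|]; last lia.
by rewrite nth_take // nth_drop; apply: hR; lia.
Qed.

Lemma frame_pops : all is_pop F.
Proof.
have [_ [_ [hF _]]] := rf; have [k0 l0 le1 le2] := frame_bounds.
apply/(all_nthP (Pop 0)) => q; rewrite size_takel ?size_drop => [lt|]; last lia.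
by rewrite nth_take // nth_drop; apply: hF; lia.
Qed.

Lemma frame_word : w = take i w ++ R ++ M ++ F ++ drop (j + l) w.
Proof.
have [k0 l0 le1 le2] := frame_bounds.
have E0 : drop j w = F ++ drop (j + l) w by rewrite addnC -drop_drop cat_take_drop.
have E1 : drop (i + k) w = M ++ drop j w.
  have -> : drop j w = drop (j - (i + k)) (drop (i + k) w) by rewrite drop_drop subnK.
  by rewrite cat_take_drop.
have E2 : drop i w = R ++ drop (i + k) w by rewrite addnC -drop_drop cat_take_drop.
by rewrite -E0 -E1 -E2 cat_take_drop.
Qed.

Lemma frame_elt e : 0 < e <= n ->
  (pt w i < e <= pt w (i + k)) = (qt w j < tm w e <= qt w (j + l)).
Proof.
move=> he; have := rf_condE wf rf he.
by rewrite [i <= _]leqNgt [j <= _]leqNgt !pb_lt // !(qb_lt wf) ?tm_rng // -!ltnNge.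
Qed.

(** The map [tm] is a bijection from the elements pushed by the rise onto the output times of the
    fall. *)
Lemma frame_total : qt w (j + l) - qt w j = N.
Proof.
rewrite -[LHS](size_iota (1 + qt w j)) -(size_iota (1 + pt w i) N) -(size_map (tm w) X).
have rX (e : nat) : e \in X -> 0 < e <= n /\ pt w i < e <= pt w (i + k).
  by rewrite mem_iota /N; have := pt_le w (i + k); have := pt_mono w (leq_addr k i); lia.
apply/perm_size/uniq_perm; rewrite ?iota_uniq //.
  rewrite map_inj_in_uniq ?iota_uniq // => e f eX fX.
  by have [he _] := rX e eX; have [hf _] := rX f fX; exact: tm_inj.
move=> t; rewrite mem_iota; apply/idP/mapP => [ht|[e eX ->]].
  have h : 0 < t <= n by have := qt_le wf (j + l); have := qt_mono w (leq_addr l j); lia.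
  have [e he Et] := tm_surj wf h; exists e => //.
  have := frame_elt he; rewrite Et mem_iota /N.
  by have := pt_mono w (leq_addr k i); have := qt_mono w (leq_addr l j); lia.
have [he hX] := rX e eX.
by have := frame_elt he; rewrite hX; have := qt_mono w (leq_addr l j); lia.
Qed.

(** The first element [f] of the last push of the rise is on top of the working stack after the rise
    and leaves only in the fall, so nothing from [f] downwards is touched in between. *)
Lemma frame_wk_prefix p : i + k <= p <= j -> exists V, wk_at w p = V ++ wk_at w (i + k).
Proof.
have [k0 l0 le1 le2] := frame_bounds.
have lt0 : i + k.-1 < size w by lia.
have isp : is_push (op_at w (i + k.-1)) by have [_ [hR _]] := rf; apply: hR; lia.
have [_ _ hf Ef] := push_exists wf lt0 isp.
set f := (pt w (i + k.-1)).+1 in hf Ef.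
have Kf : j <= qb w (tm w f) < j + l by rewrite -(rf_condE wf rf) // Ef; lia.
have fin q : i + k <= q <= j -> f \in wk_at w q.
  move=> hq; rewrite mem_wk //; last lia.
  have : pb w f < q by rewrite Ef; lia.
  have : ~~ (qb w (tm w f) < q) by lia.
  rewrite pb_lt // qb_lt ?tm_rng //; lia.
have [B EB] : exists B, wk_at w (i + k) = f :: B.
  have -> : i + k = (i + k.-1).+1 by lia.
  have [-> _] := wk_push lt0 isp; rewrite support_push_iota //.
  have [lt _ _ _] := push_exists wf lt0 isp.
  have -> : pt w (i + k.-1).+1 - pt w (i + k.-1) = (pt w (i + k.-1).+1 - f).+1.
    by rewrite /f; lia.
  by eexists.
elim: p => [|p IH] hp; first by move: hp; lia.
case: (ltnP p (i + k)) => [lt|le].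
  have -> : p.+1 = i + k by lia.
  by exists [::].
have [V EV] := IH ltac:(lia).
have ltp : p < size w by lia.
case isq : (is_push (op_at w p)).
  by have [-> _] := wk_push ltp isq; exists (support w p ++ V); rewrite EV catA.
have {}isq : is_pop (op_at w p) by move: isq; case: op_at.
have [E _] := support_pop ltp isq.
have fp := fin p.+1 hp.
have up := wk_uniq wf (ltnW ltp).
move: E up fp; rewrite EV EB; move: (support w p) (wk_at w p.+1) => s t E us ft.
have nfs : f \notin s by move: us; rewrite E cat_uniq => /and3P[_ /hasPn /(_ _ ft)].
(* A pop reaching below [V] would remove [f], the next element. *)
have ss : size s <= size V.
  rewrite leqNgt; apply/negP => lt; have := congr1 (fun x => nth 0 x (size V)) E.
  by rewrite !nth_cat ltnn subnn lt /= => Ef'; move: nfs; rewrite Ef' mem_nth.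
exists (drop (size s) V); have := congr1 (drop (size s)) E.
by rewrite (drop_catl _ ss) [in RHS]drop_size_cat // => <-.
Qed.

(** An extra element [v] on top would be popped at [j], hence in the fall, hence was pushed in the
    rise; but then [v] would occur twice on the working stack. *)
Lemma frame_wk : wk_at w j = wk_at w (i + k).
Proof.
have [k0 l0 le1 le2] := frame_bounds.
have [V EV] := @frame_wk_prefix j ltac:(lia).
case: V EV => // v V EV.
have ltj : j < size w by lia.
have isp : is_pop (op_at w j) by have [_ [_ [hF _]]] := rf; apply: hF; lia.
have [E _] := support_pop ltj isp.
have [lt _ _ _] := pop_exists wf ltj isp.
have vs : v \in support w j.
  move: E; rewrite EV; case: (support w j) (fun e => mem_support_pop wf e ltj isp).
    move=> /= h _; have [e he Ee] : exists2 e, 0 < e <= n & tm w e = (qt w j).+1.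
      by apply: tm_surj => //; have := qt_le wf j.+1; lia.
    by have := h e; rewrite he Ee ltnSn lt in_nil.
  by move=> x s _ /= [-> _]; rewrite inE eqxx.
have := vs; rewrite mem_support_pop // => /andP[hv tv].
have hv' : qb w (tm w v) = j by apply: qb_eq.
have : i <= pb w v < i + k by rewrite (rf_condE wf rf) // hv'; lia.
move=> /andP[_]; rewrite pb_lt // => lev.
have : v \in wk_at w (i + k).
  by rewrite mem_wk //; [have := qt_mono w le1; lia | lia].
have := wk_uniq wf (ltnW ltj); rewrite EV /= mem_cat => /andP[/norP[_]] /negbTE -> //.
Qed.

(** Between rise and fall the working stack never gets lower than right after the rise, and it is
    back at that height before the fall. *)
Lemma frame_balanced : okh 0 M /\ push_total M = pop_total M.
Proof.
have [k0 l0 le1 le2] := frame_bounds.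
have sz p : i + k <= p <= j -> pt w (i + k) - qt w (i + k) <= pt w p - qt w p.
  move=> hp; have [V EV] := frame_wk_prefix hp.
  have [|_ <- _ _] := size_inp_wk_out wf (i := i + k); first lia.
  have [|_ <- _ _] := size_inp_wk_out wf (i := p); first lia.
  by rewrite EV size_cat leq_addl.
have szj : pt w (i + k) - qt w (i + k) = pt w j - qt w j.
  have [|_ <- _ _] := size_inp_wk_out wf (i := i + k); first lia.
  have [|_ <- _ _] := size_inp_wk_out wf (i := j); first lia.
  by rewrite frame_wk.
have m1 := pt_mono w le1; have m2 := qt_mono w le1.
have h1 := qt_le_pt wf (i + k); have h2 := qt_le_pt wf j.
split; last by rewrite pt_take_drop qt_take_drop subnKC //; lia.
apply/okhP; split.
  have := wf.1; rewrite {1}frame_word !all_cat => /and5P[_ _] //.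
move=> m; rewrite size_take size_drop => hm.
have {}hm : m <= j - (i + k) by move: hm; case: ltnP; lia.
rewrite take_takel // pt_take_drop qt_take_drop add0n.
have := sz (i + k + m) ltac:(lia).
have := pt_mono w (leq_addr m (i + k)); have := qt_mono w (leq_addr m (i + k)).
have := qt_le_pt wf (i + k + m); lia.
Qed.

Lemma frame_input : exists inp wk out,
  [/\ state_at w i = (X ++ inp, wk, out), push_total M <= size inp & size X = N].
Proof.
have [k0 l0 le1 le2] := frame_bounds.
have [|E _ _ _] := size_inp_wk_out wf (i := i); first lia.
exists (iota (1 + pt w (i + k)) (n - pt w (i + k))), (wk_at w i), (out_at w i).
have m1 := pt_mono w (leq_addr k i); have m2 := pt_mono w le1.
have m3 := pt_le w j; have m4 := pt_le w (i + k).
split; last by rewrite size_iota.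
  rewrite [LHS](_ : _ = (inp_at w i, wk_at w i, out_at w i)).
    congr (_, _, _); rewrite E /X /N.
    have -> : n - pt w i = (pt w (i + k) - pt w i) + (n - pt w (i + k)) by lia.
    by rewrite iotaD; congr (_ ++ iota _ _); lia.
  by rewrite /inp_at /wk_at /out_at; case: (state_at w i) => [[? ?] ?].
by rewrite pt_take_drop subnKC // size_iota; lia.
Qed.

Lemma frame_totals : push_total R = N /\ pop_total F = N.
Proof. by rewrite pt_take_drop qt_take_drop -/N frame_total. Qed.

(** The fall outputs a contiguous slice of the final permutation. The effect therefore depends only
    on the permutation and on the place of the slice, which makes it comparable between two
    sequences. *)
Lemma frame_eff : eff X R F = take N (drop (n - qt w (j + l)) pi).
Proof.
have [k0 l0 le1 le2] := frame_bounds; have [tR tF] := frame_totals.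
have [inp [wk [out [Es le sX]]]] := frame_input; have [ok bal] := frame_balanced.
have [inp' [out' H]] := run_rise_fall out ok bal le.
have H2 := H X wk R F frame_pushes frame_pops (etrans tR (esym sX)) (etrans tF (esym sX)).
have S : (run_from (state_at w i) (R ++ M ++ F)) = state_at w (j + l).
  rewrite /state_at -run_from_cat; congr run_from.
  have -> : take (j + l) w = take (j + l) ((take i w ++ R ++ M ++ F) ++ drop (j + l) w).
    by rewrite -!catA -frame_word.
  by rewrite take_size_cat // /R /M /F !size_cat !size_takel ?size_drop; lia.
have [A EA] := pi_out le2; have [_ _ so _] := size_inp_wk_out wf le2.
have [B sB] : exists B, out_at w (j + l) = eff X R F ++ B.
  by rewrite /out_at -S Es H2; exists out'.
have se : size (eff X R F) = N.
  have [A' sA' HA'] := run_pushes frame_pushes (etrans tR (esym sX)).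
  have tF' : pop_total F = size A' by rewrite tF sA' sX.
  have [B' sB' HB'] := run_pops frame_pops tF'.
  rewrite /eff run_from_cat; have := HA' [::] [::] [::]; rewrite !cats0 => ->.
  by have := HB' [::] [::] [::]; rewrite !cats0 => -> /=; rewrite sB' sA' sX.
have sA : size A = n - qt w (j + l) by rewrite -(pi_size wf) EA size_cat so; lia.
by rewrite EA -sA drop_size_cat // sB take_size_cat.
Qed.

(** Both words pass the middle part in the same way and differ only through [eff], and [qlist] sees
    only the total sizes of the rise and the fall. *)
Lemma frame_replace R' F' : all is_push R' -> all is_pop F' ->
  all (fun o => 0 < op_size o) R' -> all (fun o => 0 < op_size o) F' ->
  push_total R' = N -> pop_total F' = N -> eff X R' F' = eff X R F ->
  let w2 := take i w ++ R' ++ M ++ F' ++ drop (j + l) w in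
  [/\ well_formed w2, produced_perm w2 = pi, qlist 0 w2 = qlist 0 w & op_seq_size w2 = n].
Proof.
move=> hR' hF' pR' pF' tR' tF' Ee w2.
have [tR tF] := frame_totals; have hR := frame_pushes; have hF := frame_pops.
have [inp [wk [out [Es le sX]]]] := frame_input; have [ok bal] := frame_balanced.
have En : op_seq_size w2 = n.
  rewrite [in RHS]frame_word /op_seq_size !push_total_cat tR tR'.
  by rewrite (push_total_pops hF) (push_total_pops hF').
have Ew := frame_word.
split=> //.
- have [pos [pre tot]] := wf.
  have : okh 0 w by apply/okhP.
  rewrite {1}Ew !okh_cat tR (pop_total_pushes hR) (push_total_pops hF) tF.
  move=> /and5P[o1 o2 o3 o4 o5].
  have : okh 0 w2.
    rewrite !okh_cat tR' (pop_total_pushes hR') (push_total_pops hF') tF'.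
    rewrite o1 o3 o5 (okh_pushes _ hR' pR') /= andbT; apply: okh_pops => //.
    by rewrite tF'; move: bal; lia.
  move=> /okhP[p1 p2]; split=> //; split=> //.
  have := tot; rewrite {1 2}Ew !push_total_cat !pop_total_cat tR tF tR' tF'.
  rewrite (pop_total_pushes hR) (push_total_pops hF).
  by rewrite (pop_total_pushes hR') (push_total_pops hF').
- rewrite /produced_perm {1}/init_state En -/(init_state w).
  have [inp' [out' H]] := run_rise_fall out ok bal le.
  have H1 := H X wk R F hR hF (etrans tR (esym sX)) (etrans tF (esym sX)).
  have H2 := H X wk R' F' hR' hF' (etrans tR' (esym sX)) (etrans tF' (esym sX)).
  have G A B : run_from (init_state w) (take i w ++ A ++ M ++ B ++ drop (j + l) w) =
      run_from (run_from (state_at w i) (A ++ M ++ B)) (drop (j + l) w).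
    by rewrite /state_at -!run_from_cat -!catA.
  have -> : run_from (init_state w) w =
      run_from (init_state w) (take i w ++ R ++ M ++ F ++ drop (j + l) w) by rewrite -Ew.
  by rewrite !G Es H1 H2 Ee.
- rewrite [in RHS]Ew /w2 !qlist_cat (qlist_pushes _ hR) (qlist_pushes _ hR').
  rewrite (qlist_pops _ hF) (qlist_pops _ hF') tR tR' tF tF'.
  by rewrite (push_total_pops hF) (push_total_pops hF').
Qed.

End Frame.

(** * Components of the link relation *)

Lemma samepush_sym w e f : samepush w e f = samepush w f e. Proof. exact: eq_sym. Qed.
Lemma samepop_sym w e f : samepop w e f = samepop w f e. Proof. exact: eq_sym. Qed.

(** The connected component of [e], with connectedness given as an induction principle. *)
Definition component w e (K : pred nat) :=
  [/\ K e, forall u, K u -> 0 < u <= op_seq_size w,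
      forall u v, K u -> 0 < v <= op_seq_size w -> linked w u v -> K v &
      forall C : nat -> Prop, C e ->
        (forall u v, K u -> K v -> C u -> linked w u v -> C v) -> forall v, K v -> C v].

(** Reachability in a finite graph on ordinals. The ordinal 0 is not an element, so edges into it
    are left out. *)
Lemma component_exists w e : 0 < e <= op_seq_size w -> exists K, component w e K.
Proof.
set n := op_seq_size w => he.
pose r := [rel x y : 'I_n.+1 | (0 < y) && linked w x y].
have io u : u <= n -> (inord u : 'I_n.+1) = u :> nat by move=> hu; rewrite inordK.
pose K u := (0 < u <= n) && connect r (inord e) (inord u).
exists K; split.
- by rewrite /K he connect0.
- by move=> u /andP[].
- move=> u v /andP[hu cu] hv lk; rewrite /K hv; apply: connect_trans cu (connect1 _).
  by rewrite /= !io; case/andP: hu; case/andP: hv => // ->.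
move=> C Ce step v /andP[hv /connectP[p pth lst]].
have {lst} Ev : v = last (inord e : 'I_n.+1) p by rewrite -lst io; case/andP: hv.
suff : forall x : 'I_n.+1, K x -> C x -> path r x p -> C (last x p).
  rewrite Ev; apply => //; rewrite io; case/andP: (he) => // *.
  by rewrite /K he connect0.
elim: p {pth Ev} => //= y p IH x Kx Cx /andP[/andP[y0 lk] pth].
have Ky : K y.
  case/andP: (Kx) => hx cx; rewrite /K y0 -ltnS ltn_ord /=.
  apply: connect_trans cx (connect1 _); rewrite /= !inord_val y0.
  exact: lk.
by apply: IH => //; exact: step lk.
Qed.

Lemma component_from w e K u : component w e K -> K u -> component w u K.
Proof.
move=> [Ke Kr Kc Km] Ku; split=> // C Cu step v Kv; apply: (Km C) (Kv) => //.
(* To walk from [u] back to [e], the induction from [e] proves that [C z] implies [C e]. *)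
apply: (Km (fun z => C z -> C e)) (Ku) (Cu) => // x y Kx Ky Dx lk Cy.
by apply: Dx; apply: step Cy _ => //; rewrite linked_sym.
Qed.

(** * Two sequences with the same output and the same runs *)

Section Pair.
Variables a b : seq op.
Hypotheses (wfa : well_formed a) (wfb : well_formed b).
Hypothesis En : op_seq_size a = op_seq_size b.
Hypothesis Epi : produced_perm a = produced_perm b.
Hypothesis Eq : qlist 0 a = qlist 0 b.
Local Notation n := (op_seq_size a).

Lemma pair_tm e : tm b e = tm a e. Proof. by rewrite /tm En Epi. Qed.
Lemma pair_npushed t : npushed b t = npushed a t. Proof. by rewrite /npushed Eq. Qed.

Lemma pair_pushrun e f : pushrun b e f -> pushrun a e f.
Proof. by move=> run t ht; rewrite -!pair_npushed run // -En. Qed.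

Lemma pair_poprun e f : poprun b e f -> poprun a e f.
Proof. by rewrite /poprun !pair_npushed !pair_tm. Qed.

(** If any of the four relations holds, [e] and [f] share a run in both sequences, and there the
    exclusive or is read off from the common output order. Otherwise both sides are false. *)
Lemma pair_xor e f : 0 < e <= n -> 0 < f <= n ->
  samepush a e f (+) samepop a e f = samepush b e f (+) samepop b e f.
Proof.
wlog lt : e f / e < f.
  move=> H he hf; case: (ltngtP e f) => [lt|lt|->]; first exact: H.
    have := H f e lt hf he; rewrite (samepush_sym a f) (samepop_sym a f).
    by rewrite (samepush_sym b f) (samepop_sym b f).
  by rewrite /samepush /samepop !eqxx.
move=> he hf; have [he' hf'] : 0 < e <= op_seq_size b /\ 0 < f <= op_seq_size b by rewrite -En.
have by_run : pushrun b e f \/ poprun b e f ->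
    samepush a e f (+) samepop a e f = samepush b e f (+) samepop b e f.
  move=> run; have run' : pushrun a e f \/ poprun a e f.
    by case: run => [/pair_pushrun|/pair_poprun]; [left | right].
  by rewrite -(run_order wfa he hf run' lt) -(run_order wfb he' hf' run lt) !pair_tm.
have [linked_ef|] := boolP [|| samepush b e f, samepop b e f, samepush a e f | samepop a e f].
  apply: by_run; case/or4P: linked_ef => h.
  - by left; apply: samepush_run.
  - by right; apply: samepop_run.
  - by left=> z hz; rewrite !pair_npushed; apply: samepush_run => //; rewrite En.
  - by right; rewrite /poprun !pair_npushed !pair_tm; apply: samepop_run.
by move=> /norP[/negbTE -> /norP[/negbTE -> /norP[/negbTE -> /negbTE ->]]].
Qed.

Definition moved e := exists2 f, 0 < f <= n & samepush a e f != samepush b e f.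

(** By [pair_xor] the two sequences disagree on sharing a push exactly when they disagree on sharing
    a pop, so an element and a witness of its being moved lie in one push run and one pop run. If
    the sequences disagree on [e] and [f], then [e] is a witness for [f]; otherwise the witness [g]
    of [e] serves for [f]. *)
Lemma moved_linked e f : 0 < e <= n -> 0 < f <= n -> moved e -> linked a e f ->
  [/\ moved f, pushrun a e f & poprun a e f].
Proof.
move=> he hf [g hg meg].
have Xef := pair_xor he hf; have Xeg := pair_xor he hg; have Xfg := pair_xor hf hg.
have [he' hf'] : 0 < e <= op_seq_size b /\ 0 < f <= op_seq_size b by rewrite -En.
have hg' : 0 < g <= op_seq_size b by rewrite -En.
have pushr u v : 0 < u <= n -> 0 < v <= n -> samepush a u v || samepush b u v -> pushrun a u v.
  move=> hu hv /orP[]; first exact: samepush_run.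
  by move=> h; apply: pair_pushrun; apply: samepush_run => //; rewrite -En.
have popr u v : 0 < u <= n -> 0 < v <= n -> samepop a u v || samepop b u v -> poprun a u v.
  move=> hu hv /orP[]; first exact: samepop_run.
  by move=> h; apply: pair_poprun; apply: samepop_run => //; rewrite -En.
have xor_ne (x y x' y' : bool) : x (+) y = x' (+) y' -> (x != x') = (y != y').
  by case: x y x' y' => [] [] [] [].
have ne_or (x y : bool) : x != y -> x || y by case: x y => [] [].
have pushT u v x : samepush x u v -> samepush x v g = samepush x u g by rewrite /samepush => /eqP ->.
have popT u v x : samepop x u v -> samepop x v g = samepop x u g by rewrite /samepop => /eqP ->.
have teg : samepop a e g != samepop b e g by rewrite -(xor_ne _ _ _ _ Xeg).
case/orP => [s|t].
- suff [mf rf] : moved f /\ poprun a e f by split=> //; apply: pushr => //; rewrite s.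
  have [sb|nsb] := boolP (samepush b e f); last first.
    split; first by exists e => //; rewrite !(samepush_sym _ f) s (negbTE nsb).
    by apply: popr => //; apply: ne_or; rewrite -(xor_ne _ _ _ _ Xef) s (negbTE nsb).
  have mfg : samepush a f g != samepush b f g by rewrite (pushT e) // (pushT e).
  split; first by exists g.
  have r1 : poprun a e g by apply: popr => //; exact: ne_or.
  have r2 : poprun a f g by apply: popr => //; apply: ne_or; rewrite -(xor_ne _ _ _ _ Xfg).
  by rewrite /poprun r1.
- suff [mf rf] : moved f /\ pushrun a e f by split=> //; apply: popr => //; rewrite t.
  have [tb|ntb] := boolP (samepop b e f); last first.
    have mef : samepush a e f != samepush b e f.
      by rewrite (xor_ne _ _ _ _ Xef) t (negbTE ntb).
    split; first by exists e => //; rewrite !(samepush_sym _ f).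
    by apply: pushr => //; apply: ne_or.
  have mfg : samepush a f g != samepush b f g.
    by rewrite (xor_ne _ _ _ _ Xfg) (popT e) // (popT e).
  split; first by exists g.
  have r1 : pushrun a e g by apply: pushr => //; exact: ne_or.
  have r2 : pushrun a f g by apply: pushr => //; exact: ne_or.
  by move=> z hz; rewrite r1 // r2.
Qed.

Lemma moved_rise_fall e K : moved e -> component a e K ->
  exists i k j l, rise_fall a i k j l /\
  forall z, 0 < z <= n -> K z = (i <= pb a z < i + k).
Proof.
move=> me [Ke Kr Kc Km].
apply: (@component_rise_fall a wfa e K) => // u Ku.
suff [] : moved u /\ (pushrun a e u /\ poprun a e u) by [].
apply: (Km (fun u => moved u /\ (pushrun a e u /\ poprun a e u))) Ku; first by [].
move=> {}u v Ku Kv [mu [r1 r2]] lk.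
have [mv r3 r4] := moved_linked (Kr _ Ku) (Kr _ Kv) mu lk.
split=> //; split; last by rewrite /poprun r2.
by move=> t ht; rewrite r1 // r3.
Qed.

(* If the [b]-component of [e] sticks out of its [a]-component, a crossing
   [b]-link is not an [a]-link, so it is both a push link and a pop link, and
   then all of the [b]-component is one push block and one pop block. *)
Lemma crossing_component e Ka Kb v : component a e Ka -> component b e Kb ->
  Kb v -> ~~ Ka v -> exists2 u, Kb u & 
  [/\ forall z, Kb z -> samepush b u z /\ samepop b u z & exists2 z, Kb z & z != u].
Proof.
move=> [Ae Ar Ac Am] cb Kbv nKav; have [Be Br Bc Bm] := cb.
pose cross := has (fun u => has (fun v => [&& Ka u, Kb u, linked b u v & ~~ Ka v]) (iota 1 n)) (iota 1 n).
have mi z : 0 < z <= n -> z \in iota 1 n by rewrite mem_iota; lia.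
have [/hasP[u _ /hasP[z hz /and4P[Au Bu lk nAz]]]|ncross] := boolP cross; last first.
  suff : Ka v by rewrite (negbTE nKav).
  apply: (Bm Ka) (Kbv) => // x y Bx By Ax lk; apply/negPn/negP => nAy.
  have yi : y \in iota 1 n by apply: mi; rewrite En; exact: Br.
  by move/hasPn: ncross => /(_ x (mi _ (Ar _ Ax))) /hasPn /(_ y yi); rewrite Ax Bx lk nAy.
have hu := Ar _ Au; have {}hz : 0 < z <= n by move: hz; rewrite mem_iota; lia.
have Bz : Kb z by apply: Bc lk => //; rewrite -En.
have nlk : ~~ linked a u z by apply: contra nAz; exact: Ac.
(* Not being linked in [a] makes the exclusive or false, so a link in [b] must be of both kinds. *)
have [sb tb] : samepush b u z /\ samepop b u z.
  move: lk nlk (pair_xor hu hz); rewrite /linked.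
  by case: (samepush a u z) (samepop a u z) (samepush b u z) (samepop b u z) => [] [] [] [].
(* If only one relation held between [u] and [y], the exclusive or would be true for [u] and [y] and
   for [z] and [y]. Then [a] would link [u] to [y] and [y] to [z], although [z] is outside [Ka]. *)
have same y : 0 < y <= n -> samepush b u y = samepop b u y.
  move=> hy; have [//|ne] := eqVneq (samepush b u y) (samepop b u y).
  have Su : samepush b z y = samepush b u y by move: sb; rewrite /samepush => /eqP ->.
  have Tu : samepop b z y = samepop b u y by move: tb; rewrite /samepop => /eqP ->.
  have link x : 0 < x <= n -> samepush b x y != samepop b x y -> linked a x y.
    move=> hx; move: (pair_xor hx hy); rewrite /linked.
    by case: (samepush a x y) (samepop a x y) (samepush b x y) (samepop b x y) => [] [] [] [].
  have Ay : Ka y by apply: Ac (link u hu ne).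
  move: nAz; rewrite (Ac y z) // linked_sym; apply: link => //.
  by rewrite Su Tu.
exists u => //; split; last first.
  exists z => //; apply: contraNneq nAz => ->; exact: Au.
move=> y By; have hy : 0 < y <= n by rewrite En; exact: Br.
rewrite -same //; suff : samepush b u y by [].
have [_ _ _ Bmu] := component_from cb Bu.
apply: (Bmu (fun y => samepush b u y)) By; first by rewrite /samepush.
move=> x x' Bx Bx' sx /orP[].
  by move: sx; rewrite /samepush => /eqP ->.
have rx z' : Kb z' -> 0 < z' <= n by rewrite En; exact: Br.
rewrite (same x (rx _ Bx)) in sx; rewrite (same x' (rx _ Bx')).
by move: sx; rewrite /samepop => /eqP ->.
Qed.

End Pair.

(** * Replacement steps that merge or split *)

Definition good_step w w' :=
  [/\ rf_step w w', well_formed w', produced_perm w' = produced_perm w,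
      qlist 0 w' = qlist 0 w & op_seq_size w' = op_seq_size w].

Lemma size_replace w i k j l R' F' : rf_cond w i k j l ->
  size (take i w ++ R' ++ take (j - (i + k)) (drop (i + k) w) ++ F' ++ drop (j + l) w)
    + k + l = size w + size R' + size F'.
Proof. by move=> [[k0 l0 le1 le2] _]; rewrite !size_cat !size_takel ?size_drop; lia. Qed.

Lemma rf_cond_intervals w i k j l : well_formed w -> rf_cond w i k j l ->
  pt w i < pt w (i + k) /\ qt w j < qt w (j + l).
Proof.
move=> wf rf; have [[k0 l0 le1 le2] [hR [hF _]]] := rf.
have [||lt1 _ _ _] := push_exists wf (i := i); [lia | apply: hR; lia |].
have [||lt2 _ _ _] := pop_exists wf (i := j); [lia | apply: hF; lia |].
have := pt_mono w (i := i.+1) (j := i + k); have := qt_mono w (i := j.+1) (j := j + l).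
by lia.
Qed.

Lemma interval_inj x y x' y' m : x < y <= m -> x' < y' <= m ->
  (forall z, 0 < z <= m -> (x < z <= y) = (x' < z <= y')) -> x = x' /\ y = y'.
Proof.
move=> h h' H.
have h1 : x < x'.+1 <= y by rewrite H; lia.
have h2 : x' < x.+1 <= y' by rewrite -H; lia.
have h3 : x < y' <= y by rewrite H; lia.
have h4 : x' < y <= y' by rewrite -H; lia.
lia.
Qed.

(** Equal sets of elements occupy the same interval of inputs and of output times, so both effects
    are the same slice of the common permutation. *)
Lemma merge_step a b i k j l i' k' j' l' : well_formed a -> well_formed b ->
  op_seq_size a = op_seq_size b -> produced_perm a = produced_perm b ->
  rise_fall a i k j l -> rf_cond b i' k' j' l' ->
  (forall z, 0 < z <= op_seq_size a -> (i <= pb a z < i + k) = (i' <= pb b z < i' + k')) ->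
  pt a i = pt b i' /\
  good_step a (take i a ++ take k' (drop i' b) ++ take (j - (i + k)) (drop (i + k) a)
                ++ take l' (drop j' b) ++ drop (j + l) a).
Proof.
move=> wfa wfb En Epi rfa rfb HK; have rfa1 := rfa.1.
have [ha1 ha2] := rf_cond_intervals wfa rfa1; have [hb1 hb2] := rf_cond_intervals wfb rfb.
have Etm z : tm b z = tm a z by rewrite /tm En Epi.
have [E1 E2] : pt a i = pt b i' /\ pt a (i + k) = pt b (i' + k').
  apply: (@interval_inj _ _ _ _ (op_seq_size a)); rewrite ?ha1 ?hb1 ?pt_le // ?En ?pt_le //.
  move=> z hz; have hza : 0 < z <= op_seq_size a by rewrite En.
  have := HK z hza; rewrite [i <= _]leqNgt [i' <= _]leqNgt.
  by rewrite !(@pb_lt a) // !(@pb_lt b) // -!ltnNge.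
have [E3 E4] : qt a j = qt b j' /\ qt a (j + l) = qt b (j' + l').
  apply: (@interval_inj _ _ _ _ (op_seq_size a)); rewrite ?ha2 ?hb2 ?qt_le // ?En ?qt_le //.
  move=> t ht; rewrite -En in ht; have [z hz Ez] := tm_surj wfa ht.
  rewrite -Ez -(frame_elt wfa rfa1) // -Etm -(frame_elt wfb rfb) -?En //.
  by rewrite E1 E2.
split=> //.
have hR := frame_pushes rfb; have hF := frame_pops rfb.
have := wfb.1; rewrite {1}(frame_word rfb) !all_cat => /and5P[_ pR _ pF _].
have [tR tF] := frame_totals wfb rfb.
have := frame_replace wfa rfa1 hR hF pR pF.
rewrite tR tF E1 E2 => /(_ erefl erefl).
have -> : eff (iota (1 + pt b i') (pt b (i' + k') - pt b i')) (take k' (drop i' b)) (take l' (drop j' b))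
   = eff (iota (1 + pt b i') (pt b (i' + k') - pt b i')) (take k (drop i a)) (take l (drop j a)).
  by rewrite (frame_eff wfb rfb) -E1 -E2 (frame_eff wfa rfa1) E4 Epi En.
move=> /(_ erefl)[wf' Ep Eq' En']; split=> //; split=> //; split=> //.
by exists i, k, j, l, (take k' (drop i' b)), (take l' (drop j' b)).
Qed.

(** Unit pushes reverse the block and unit pops reverse it back. *)
Lemma eff_units X : eff X (nseq (size X) (Push 1)) (nseq (size X) (Pop 1)) = X.
Proof.
have pushes Y Z : run_from (Y, Z, [::]) (nseq (size Y) (Push 1)) = ([::], rev Y ++ Z, [::]).
  by elim: Y Z => //= y Y IH Z; rewrite /run_from /= take0 drop0 -/(run_from _ _) IH rev_cons cat_rcons.
have pops Y Z : run_from ([::], Y, Z) (nseq (size Y) (Pop 1)) = ([::], [::], rev Y ++ Z).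
  by elim: Y Z => //= y Y IH Z; rewrite /run_from /= take0 drop0 -/(run_from _ _) IH rev_cons cat_rcons.
by rewrite /eff run_from_cat pushes cats0 -(size_rev X) pops cats0 revK.
Qed.

(** Sharing one push and one pop, the elements are carried by single operations of equal size [N],
    which act like [N] unit pushes and [N] unit pops. A second element gives [1 < N], so the word
    grows. *)
Lemma split_step b i k j l u : well_formed b -> rise_fall b i k j l ->
  i <= pb b u < i + k -> 0 < u <= op_seq_size b ->
  (forall z, 0 < z <= op_seq_size b -> i <= pb b z < i + k -> samepush b u z /\ samepop b u z) ->
  (exists2 z, 0 < z <= op_seq_size b & i <= pb b z < i + k /\ z != u) ->
  exists2 b', good_step b b' & size b < size b'.
Proof.
move=> wfb rfb Ku hu same [z hz [Kz ne]]; have rfb1 := rfb.1.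
have [[k0 l0 le1 le2] [hR [hF _]]] := rfb1.
have posR q : i <= q < i + k -> pb b u = q.
  move=> hq; have [||_ _ hg Eg] := push_exists wfb (i := q); [lia | exact: hR |].
  by have [|/eqP-> _] := same _ hg; rewrite Eg.
have posF p : j <= p < j + l -> qb b (tm b u) = p.
  move=> hp; have [||_ _ ht Et] := pop_exists wfb (i := p); [lia | exact: hF |].
  have [g hg Eg] := tm_surj wfb ht.
  have Kg : i <= pb b g < i + k by rewrite (rf_condE wfb rfb1) // Eg Et.
  by have [_ /eqP->] := same _ hg Kg; rewrite Eg Et.
have Ek : k = 1 by have := posR i; have := posR (i + k.-1); lia.
have El : l = 1 by have := posF j; have := posF (j + l.-1); lia.
subst k l.
have lti : i < size b by lia.
have ltj : j < size b by lia.
have [tR tF] := frame_totals wfb rfb1.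
have ER : take 1 (drop i b) = [:: op_at b i] by rewrite (drop_nth (Pop 0)) //= take0.
have EF : take 1 (drop j b) = [:: op_at b j] by rewrite (drop_nth (Pop 0)) //= take0.
set N := pt b (i + 1) - pt b i in tR tF.
have PN : op_at b i = Push N.
  have := hR i ltac:(lia); move: tR; rewrite ER push_total_cons.
  by case: (op_at b i) => //= x <- _; rewrite addn0.
have QN : op_at b j = Pop N.
  have := hF j ltac:(lia); move: tF; rewrite EF pop_total_cons.
  by case: (op_at b j) => //= x <- _; rewrite addn0.
have N2 : 1 < N.
  have [_ u1 u2] := pbP hu; have [_ z1 z2] := pbP hz.
  have Eu : pb b u = i by lia.
  have Ez : pb b z = i by lia.
  by move: u1 u2 z1 z2; rewrite /N Eu Ez addn1; lia.
set X := iota (1 + pt b i) N.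
have sX : size X = N by rewrite size_iota.
have := @frame_replace b wfb i 1 j 1 rfb1 (nseq N (Push 1)) (nseq N (Pop 1)).
rewrite !all_nseq !orbT -/N -/X => /(_ isT isT isT isT).
have -> : push_total (nseq N (Push 1)) = N.
  by elim: (N) => //= m IH; rewrite push_total_cons IH.
have -> : pop_total (nseq N (Pop 1)) = N.
  by elim: (N) => //= m IH; rewrite pop_total_cons IH.
have -> : eff X (nseq N (Push 1)) (nseq N (Pop 1)) = X by rewrite -sX eff_units.
have -> : eff X (take 1 (drop i b)) (take 1 (drop j b)) = X.
  by rewrite ER EF PN QN /eff /run_from /= cats0 take_oversize ?sX // cats0 take_oversize ?sX.
move=> /(_ erefl erefl erefl)[wf' Ep Eq En].
exists (take i b ++ nseq N (Push 1) ++ take (j - (i + 1)) (drop (i + 1) b) ++ nseq N (Pop 1) ++ drop (j + 1) b).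
  split=> //; split=> //; split=> //.
  by exists i, 1, j, 1, (nseq N (Push 1)), (nseq N (Pop 1)); rewrite !all_nseq !orbT.
by have := size_replace (nseq N (Push 1)) (nseq N (Pop 1)) rfb1; rewrite !size_nseq; lia.
Qed.

(** * Longest common prefixes *)

Definition op_eqb (x y : op) :=
  match x, y with
  | Push a, Push b | Pop a, Pop b => a == b
  | _, _ => false
  end.

Lemma op_eqbP x y : reflect (x = y) (op_eqb x y).
Proof.
by case: x y => [] a [] b /=; apply: (iffP idP) => // [/eqP ->|[->]].
Qed.

Lemma op_seq_dec (u v : seq op) : u = v \/ u <> v.
Proof.
elim: u v => [|x u IH] [|y v]; [by left | by right | by right |].
case: (op_eqbP x y) => [->|ne]; last by right=> [[]].
by case: (IH v) => [->|ne]; [left | right=> [[]]].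
Qed.

Fixpoint lcp (u v : seq op) : nat :=
  match u, v with
  | x :: u', y :: v' => if op_eqb x y then (lcp u' v').+1 else 0
  | _, _ => 0
  end.

Lemma lcp_size u v : lcp u v <= size u.
Proof. by elim: u v => [|x u IH] [|y v] //=; case: ifP => // _; exact: IH. Qed.

Lemma lcpC u v : lcp u v = lcp v u.
Proof.
elim: u v => [|x u IH] [|y v] //=.
case: (op_eqbP x y) => [->|ne]; last by case: op_eqbP => // e; case: ne.
have -> : op_eqb y y by apply/op_eqbP.
by rewrite IH.
Qed.

Lemma lcp_take u v : take (lcp u v) u = take (lcp u v) v.
Proof.
elim: u v => [|x u IH] [|y v] //=.
by case: op_eqbP => [->|//]; rewrite /= IH.
Qed.

Lemma lcp_op_at u v : lcp u v < size u -> lcp u v < size v -> op_at u (lcp u v) <> op_at v (lcp u v).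
Proof.
elim: u v => [|x u IH] [|y v] //=.
by case: op_eqbP => [->|//] /=; rewrite !ltnS => h1 h2; exact: IH.
Qed.

Lemma lcp_cat p u v : size p <= lcp (p ++ u) (p ++ v).
Proof. by elim: p => //= x p IH; case: op_eqbP. Qed.

Lemma size_wf w : well_formed w -> size w <= (op_seq_size w).*2.
Proof.
move=> [pos [_ E]]; rewrite -addnn {2}/op_seq_size E.
elim: w pos {E} => //= o w IH /andP[o0 /IH].
by rewrite /op_seq_size push_total_cons pop_total_cons; case: o o0 => a /=; lia.
Qed.

(** * The first difference of two sequences *)

Section FirstDifference.
Variables a b : seq op.
Hypotheses (wfa : well_formed a) (wfb : well_formed b).
Hypothesis En : op_seq_size a = op_seq_size b.
Hypothesis Epi : produced_perm a = produced_perm b.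
Hypothesis Eq : qlist 0 a = qlist 0 b.
Local Notation c := (lcp a b).

Lemma prefix_pt i : i <= c -> pt a i = pt b i.
Proof. by move=> le; rewrite /pt -(take_takel a le) -(take_takel b le) lcp_take. Qed.

Lemma prefix_qt i : i <= c -> qt a i = qt b i.
Proof. by move=> le; rewrite /qt -(take_takel a le) -(take_takel b le) lcp_take. Qed.

Lemma prefix_pb e : 0 < e <= pt a c -> pb a e = pb b e.
Proof.
move=> he; have h : 0 < e <= op_seq_size a by have := pt_le a c; lia.
have lt : pb a e < c by rewrite pb_lt //; lia.
have [_ lo hi] := pbP h; apply/esym/pb_eq.
  by have := lcp_size b a; rewrite -lcpC; lia.
by rewrite -!prefix_pt //; [rewrite lo | lia].
Qed.

(** If [a] ended at the common prefix, all elements would already be pushed and output, leaving no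
    room for another operation of positive size in [b]. *)
Lemma not_prefix : c < size b -> c < size a.
Proof.
move=> ltb; rewrite ltn_neqAle lcp_size andbT; apply/eqP => E.
have := prefix_pt (leqnn c); have := prefix_qt (leqnn c).
rewrite {1 3}E pt_size qt_size //.
have := wf_pos wfb ltb; have := pt_le b c.+1; have := qt_le wfb c.+1.
by rewrite ptS // qtS //; case: (op_at b c) => x /=; lia.
Qed.

(** At the next output [b] has pushed [pt b c] elements and [a] more than that, against the equality
    of [qlist]. *)
Lemma not_push_pop : c < size a -> c < size b ->
  is_push (op_at a c) -> is_pop (op_at b c) -> False.
Proof.
move=> lta ltb pa pb'.
have [p1 q1 _ _] := push_exists wfa lta pa; have [q2 p2 ht Et] := pop_exists wfb ltb pb'.
have Ec := prefix_pt (leqnn c); have Eqc := prefix_qt (leqnn c).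
have : npushed b (qt b c).+1 = pt b c by apply: npushedE => //; rewrite ltnSn q2.
rewrite /npushed -Eq -/(npushed a _) => E.
have ht' : 0 < (qt b c).+1 <= op_seq_size a by rewrite En.
rewrite npushed_qb // in E.
have : c < qb a (qt b c).+1 by rewrite ltnNge qb_le // q1 Eqc ltnn.
by move=> /(pt_mono a); rewrite E; lia.
Qed.

(** The last output [e] of the shorter pop and the next output [f] share a pop in [b] but not in
    [a]. Both were pushed in the common prefix, where the push blocks agree, against [pair_xor]. *)
Lemma not_pop_pop x y : c < size a -> c < size b ->
  op_at a c = Pop x -> op_at b c = Pop y -> x < y -> False.
Proof.
move=> lta ltb pa pb' lt.
have Ec := prefix_pt (leqnn c); have Eqc := prefix_qt (leqnn c).
have x0 : 0 < x by have := wf_pos wfa lta; rewrite pa.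
have qa : qt a c.+1 = qt a c + x by rewrite qtS // pa.
have qbc : qt b c.+1 = qt b c + y by rewrite qtS // pb'.
have rb := qt_le wfb c.+1; have ra := qt_le wfa c.+1.
have [e he Ee] : exists2 e, 0 < e <= op_seq_size b & tm b e = qt b c + x.
  by apply: tm_surj => //; lia.
have [f hf Ef] : exists2 f, 0 < f <= op_seq_size b & tm b f = (qt b c + x).+1.
  by apply: tm_surj => //; lia.
have Bc z : 0 < z <= op_seq_size b -> qt b c < tm b z <= qt b c.+1 -> 0 < z <= pt a c.
  move=> hz tz; have isb : is_pop (op_at b c) by rewrite pb'.
  have [E _] := support_pop ltb isb.
  have : z \in wk_at b c by rewrite E mem_cat mem_support_pop // hz tz.
  by rewrite mem_wk ?(ltnW ltb) // Ec => /and3P[-> ->].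
have Be : 0 < e <= pt a c by apply: Bc => //; lia.
have Bf : 0 < f <= pt a c by apply: Bc => //; lia.
have tb : samepop b e f.
  by rewrite /samepop !(@qb_eq b _ c) //; lia.
have Etm z : tm a z = tm b z by rewrite /tm En Epi.
have ta : ~~ samepop a e f.
  rewrite /samepop !Etm Ee Ef (@qb_eq a _ c) //; last by lia.
  apply/eqP => E; have ht : 0 < (qt b c + x).+1 <= op_seq_size a by lia.
  by have := qb_le wfa c ht; rewrite -E leqnn; lia.
have [he' hf'] : 0 < e <= op_seq_size a /\ 0 < f <= op_seq_size a by rewrite En.
have := pair_xor wfa wfb En Epi Eq he' hf'; rewrite tb (negbTE ta).
by rewrite /samepush !prefix_pb //; case: (_ == _).
Qed.

End FirstDifference.

(** * One improving step for a pair of sequences *)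

Section PairStep.
Variables a b : seq op.
Hypotheses (wfa : well_formed a) (wfb : well_formed b).
Hypothesis En : op_seq_size a = op_seq_size b.
Hypothesis Epi : produced_perm a = produced_perm b.
Hypothesis Eq : qlist 0 a = qlist 0 b.
Local Notation n := (op_seq_size a).
Local Notation c := (lcp a b).

Lemma first_difference : a <> b -> exists x y,
  [/\ c < size a, c < size b, op_at a c = Push x, op_at b c = Push y & x != y].
Proof.
move=> ne; have Ec : lcp b a = c by exact: lcpC.
have notp := not_prefix wfa wfb En.
have notp' := not_prefix wfb wfa (esym En); rewrite Ec in notp'.
have lta : c < size a.
  rewrite ltnNge; apply/negP => le; apply: ne.
  have le' : size b <= c by rewrite leqNgt; apply/negP => /notp; lia.
  by rewrite -(take_oversize le) lcp_take take_oversize.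
have ltb := notp' lta.
have := lcp_op_at lta ltb.
have h1 := not_push_pop wfa wfb En Eq lta ltb.
have h2 := not_push_pop wfb wfa (esym En) (esym Eq); rewrite Ec in h2.
have {}h2 := h2 ltb lta.
have h3 := not_pop_pop wfa wfb En Epi Eq lta ltb.
have h4 x y := @not_pop_pop b a wfb wfa (esym En) (esym Epi) (esym Eq) x y; rewrite Ec in h4.
case Ea : (op_at a c) h1 h2 => [x|x] h1 h2; case Eb : (op_at b c) h1 h2 => [y|y] h1 h2 nxy.
- by exists x, y; split=> //; apply: contra_not_neq nxy => ->.
- by case: (h1 isT isT).
- by case: (h2 isT isT).
- case: (ltngtP x y) => [lt|lt|E]; last by case: nxy; rewrite E.
    by case: (h3 x y Ea Eb lt).
  by case: (h4 y x ltb lta Eb Ea lt).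
Qed.

Lemma first_moved : a <> b -> exists2 e, 0 < e <= n &
  [/\ moved a b e, pb a e = c & pb b e = c].
Proof.
move=> /first_difference[x [y [lta ltb Ea Eb ne]]].
have [pa _ he Ee] := push_exists wfa lta (etrans (congr1 _ Ea) erefl).
have [pb' _ he' Ee'] := push_exists wfb ltb (etrans (congr1 _ Eb) erefl).
have Ec := prefix_pt (leqnn c).
have Pa : pt a c.+1 = pt a c + x by rewrite ptS // Ea.
have Pb : pt b c.+1 = pt b c + y by rewrite ptS // Eb.
have la := pt_le a c.+1; have lb := pt_le b c.+1.
exists (pt a c).+1 => //; split=> //; last by rewrite Ec.
(* The first element beyond the shorter block shares the push of the chosen element in exactly one
   of the two sequences. *)
exists (pt a c + minn x y).+1; first by lia.
rewrite /samepush Ee {2}Ec Ee'.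
case: (ltngtP x y) ne => // lt _.
- have -> : pb b (pt a c + x).+1 = c by apply: pb_eq => //; lia.
  suff : pb a (pt a c + x).+1 != c by rewrite eqxx eq_sym => /negbTE ->.
  have hf : 0 < (pt a c + x).+1 <= n by lia.
  by apply/eqP => E; have := pb_le c hf; rewrite E leqnn Pa; lia.
- have -> : pb a (pt a c + y).+1 = c by apply: pb_eq => //; lia.
  suff : pb b (pt a c + y).+1 != c by rewrite eqxx eq_sym => /negbTE ->.
  have hf : 0 < (pt a c + y).+1 <= op_seq_size b by lia.
  by apply/eqP => E; have := pb_le c hf; rewrite E leqnn Pb; lia.
Qed.

(** Agreement before the first difference forces both rises to start at the same position. After the
    replacement the words agree up to the end of the rise of [b], which lies beyond that
    difference. *)
Lemma merge_case i k j l i' k' j' l' :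
  rise_fall a i k j l -> rise_fall b i' k' j' l' ->
  (forall z, 0 < z <= n -> (i <= pb a z < i + k) = (i' <= pb b z < i' + k')) ->
  i <= c < i + k -> i' <= c < i' + k' -> k + l <= k' + l' ->
  exists2 a', good_step a a' & size a <= size a' /\ c < lcp a' b.
Proof.
move=> rfa rfb HK hc hc' le.
have [E good] := merge_step wfa wfb En Epi rfa rfb.1 HK.
have [[_ _ ka la] [hR _]] := rfa.1; have [[_ _ kb lb] [hR' _]] := rfb.1.
have Ei : i = i'.
  case: (ltngtP i i') => // lt.
  - have [||h _ _ _] := push_exists wfa (i := i); [lia | apply: hR; lia |].
    by move: h; rewrite (@prefix_pt a b i.+1) ?E; [have := pt_mono b lt; lia | lia].
  - have [||h _ _ _] := push_exists wfb (i := i'); [lia | apply: hR'; lia |].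
    by move: h; rewrite -(@prefix_pt a b i'.+1) -?E; [have := pt_mono a lt; lia | lia].
subst i'; eexists; first exact: good.
have := size_replace (take k' (drop i b)) (take l' (drop j' b)) rfa.1.
have sR : size (take k' (drop i b)) = k' by rewrite size_takel // size_drop; lia.
have sF : size (take l' (drop j' b)) = l' by rewrite size_takel // size_drop; lia.
rewrite sR sF => sz; split; first lia.
have Et : take i a = take i b.
  have lei : i <= c by lia.
  by rewrite -(take_takel a lei) -(take_takel b lei) lcp_take.
have Eb := frame_word rfb.1.
have sP : size (take i b ++ take k' (drop i b)) = i + k'.
  by rewrite size_cat sR size_takel //; lia.
have prefix u v : i + k' <= lcp (take i b ++ take k' (drop i b) ++ u)
                                (take i b ++ take k' (drop i b) ++ v).
  by rewrite -sP !(catA (take i b)); exact: lcp_cat.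
by rewrite Et [X in _ < lcp _ X]Eb; apply: leq_trans (prefix _ _); lia.
Qed.

Lemma split_case e Ka Kb v : moved b a e -> component a e Ka -> component b e Kb ->
  Kb v -> ~~ Ka v -> exists2 b', good_step b b' & size b < size b'.
Proof.
move=> mv ca cb Kbv nKav; have [_ Kr _ _] := cb.
have [i [k [j [l [rf KE]]]]] := moved_rise_fall wfb wfa (esym En) (esym Epi) (esym Eq) mv cb.
have [u Ku [same [z Kz ne]]] := crossing_component wfa wfb En Epi Eq ca cb Kbv nKav.
apply: (split_step (u := u) wfb rf).
- by rewrite -KE ?Ku //; exact: Kr.
- exact: Kr.
- by move=> y hy; rewrite -KE //; exact: same.
- by exists z; [exact: Kr | rewrite -KE ?Kz //; exact: Kr].
Qed.

End PairStep.

Lemma pair_step a b : well_formed a -> well_formed b ->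
  op_seq_size a = op_seq_size b -> produced_perm a = produced_perm b ->
  qlist 0 a = qlist 0 b -> a <> b ->
  (exists2 a', good_step a a' &
     size a < size a' \/ size a <= size a' /\ lcp a b < lcp a' b) \/
  (exists2 b', good_step b b' &
     size b < size b' \/ size b <= size b' /\ lcp a b < lcp a b').
Proof.
move=> wfa wfb En Epi Eq ne.
have [e he [mv Ea Eb]] := first_moved wfa wfb En Epi Eq ne.
have mv' : moved b a e.
  by case: mv => f hf h; exists f; rewrite -?En // eq_sym.
have he' : 0 < e <= op_seq_size b by rewrite -En.
have [Ka ca] := component_exists he; have [Kb cb] := component_exists he'.
have [[Kae Kar _ _] [Kbe Kbr _ _]] := (ca, cb).
have [/hasP[v _ /andP[Kbv nKav]]|nb] := boolP (has (fun v => Kb v && ~~ Ka v) (iota 1 (op_seq_size a))).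
  have [b' good lt] := split_case wfa wfb En Epi Eq mv' ca cb Kbv nKav.
  by right; exists b' => //; left.
have [/hasP[v _ /andP[Kav nKbv]]|na] := boolP (has (fun v => Ka v && ~~ Kb v) (iota 1 (op_seq_size a))).
  have [a' good lt] := split_case wfb wfa (esym En) (esym Epi) (esym Eq) mv cb ca Kav nKbv.
  by left; exists a' => //; left.
have [i [k [j [l [rfa KaE]]]]] := moved_rise_fall wfa wfb En Epi Eq mv ca.
have [i' [k' [j' [l' [rfb KbE]]]]] :=
  moved_rise_fall wfb wfa (esym En) (esym Epi) (esym Eq) mv' cb.
have HK z : 0 < z <= op_seq_size a -> (i <= pb a z < i + k) = (i' <= pb b z < i' + k').
  move=> hz; rewrite -KaE // -KbE -?En //.
  have zi : z \in iota 1 (op_seq_size a) by rewrite mem_iota; lia.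
  by move/hasPn: na => /(_ z zi); move/hasPn: nb => /(_ z zi); case: (Ka z) (Kb z) => [] [].
have hc : i <= lcp a b < i + k by rewrite -Ea -KaE.
have hc' : i' <= lcp a b < i' + k' by rewrite -Eb -KbE.
(* Equal components are exchanged in the direction that does not shorten the word. *)
have [le|/ltnW le] := leqP (k + l) (k' + l').
  have [a' good lt] := merge_case wfa wfb En Epi rfa rfb HK hc hc' le.
  by left; exists a' => //; right.
have HK' z : 0 < z <= op_seq_size b -> (i' <= pb b z < i' + k') = (i <= pb a z < i + k).
  by move=> hz; rewrite HK // En.
have := merge_case wfb wfa (esym En) (esym Epi) rfb rfa HK'; rewrite lcpC.
move=> /(_ hc' hc le)[b' good lt].
by right; exists b' => //; right; rewrite [lcp a b']lcpC.
Qed.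

(** * Chains and termination *)

Definition rf_connected a b := exists gs, rf_chain a gs /\ last a gs = b.

Lemma rf_connected_trans a b d : rf_connected a b -> rf_connected b d -> rf_connected a d.
Proof.
move=> [gs [ch <-]] [hs [ch' <-]]; exists (gs ++ hs); rewrite last_cat; split=> //.
by elim: gs a ch ch' => //= g gs IH a [r ch] ch'; split=> //; exact: IH.
Qed.

Lemma rf_connected1 a b : rf_related a b -> rf_connected a b.
Proof. by move=> r; exists [:: b]. Qed.

Lemma rf_related_sym a b : rf_related a b -> rf_related b a.
Proof. by case; [right | left]. Qed.

Lemma equal_qlist_connected a b : well_formed a -> well_formed b ->
  op_seq_size a = op_seq_size b -> produced_perm a = produced_perm b ->
  qlist 0 a = qlist 0 b -> rf_connected a b.
Proof.
(* A lexicographic measure in one number. Each word has at most [2n] operations, so the deficit in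
   operations is weighted by [2n + 1] to dominate the deficit in the common prefix. *)
pose mu n a b := (n.*2.*2 - (size a + size b)) * n.*2.+1 + (n.*2 - lcp a b).
have descend n a1 b1 a2 b2 : size a2 + size b2 <= n.*2.*2 -> lcp a2 b2 <= n.*2 ->
    size a1 + size b1 < size a2 + size b2 \/
    size a1 + size b1 <= size a2 + size b2 /\ lcp a1 b1 < lcp a2 b2 ->
    mu n a2 b2 < mu n a1 b1.
  move=> s2 l2 [lt|[le lt]]; rewrite /mu.
    have le : (n.*2.*2 - (size a2 + size b2)).+1 <= n.*2.*2 - (size a1 + size b1) by lia.
    apply: leq_trans (leq_addr _ _); apply: leq_trans (leq_mul le (leqnn _)).
    by rewrite mulSn [_ + (_ - lcp _ _)]addnC ltn_add2r ltnS leq_subr.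
  have {}le : n.*2.*2 - (size a2 + size b2) <= n.*2.*2 - (size a1 + size b1) by lia.
  by rewrite -addnS; apply: leq_add; [exact: leq_mul | lia].
have [m] := ubnP (mu (op_seq_size a) a b); elim: m a b => // m IH a b ub wfa wfb En Epi Eq.
have bounds x y : well_formed x -> well_formed y ->
    op_seq_size x = op_seq_size a -> op_seq_size y = op_seq_size a ->
    size x + size y <= (op_seq_size a).*2.*2 /\ lcp x y <= (op_seq_size a).*2.
  move=> wfx wfy Ex Ey; have := size_wf wfx; have := size_wf wfy; have := lcp_size x y.
  by rewrite Ex Ey; lia.
have [<-|ne] := op_seq_dec a b; first by exists [::].
case: (pair_step wfa wfb En Epi Eq ne) => [[a' [st wf' Ep' Eq' En'] dec]|[b' [st wf' Ep' Eq' En'] dec]].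
- apply: (rf_connected_trans (b := a')); first by apply: rf_connected1; left.
  apply: IH; rewrite ?En' ?Ep' ?Eq' //.
  have [s2 l2] := bounds a' b wf' wfb En' (esym En).
  by apply: leq_trans (descend _ a b _ _ s2 l2 _) ub; lia.
(* A step made on [b] is read backwards and closes the chain. *)
- apply: (rf_connected_trans (b := b')); last by apply/rf_connected1/rf_related_sym; left.
  apply: IH; rewrite ?En' ?Ep' ?Eq' //.
  have [s2 l2] := bounds a b' wfa wf' erefl (etrans En' (esym En)).
  by apply: leq_trans (descend _ a b _ _ s2 l2 _) ub; lia.
Qed.

(** * Reduced sequences: the output determines the runs *)

Lemma npushed_mono w s t : well_formed w -> 0 < s <= op_seq_size w ->
  0 < t <= op_seq_size w -> s <= t -> npushed w s <= npushed w t.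
Proof.
by move=> wf hs ht le; rewrite !npushed_qb //; apply/pt_mono/qb_mono.
Qed.

(* In a reduced sequence every run of pops starts by popping the element
   pushed last, so the number of pushed elements is the running maximum of the
   outputs; thus the permutation determines all push and pop runs. *)
Lemma reduced_pop_max w j : well_formed w -> reduced w -> j < size w -> is_pop (op_at w j) ->
  0 < pt w j /\ tm w (pt w j) <= (qt w j).+1.
Proof.
move=> wf red; elim: j => [|j IH] lt isp.
  have [h1 h2 _ _] := pop_exists wf lt isp.
  by have := qt_le_pt wf 1; rewrite h2 pt0; move: h1; lia.
have ltj : j < size w by lia.
case isq : (is_push (op_at w j)); last first.
  have isp' : is_pop (op_at w j) by move: isq; case: op_at.
  have [h1 h2 _ _] := pop_exists wf ltj isp'.
  by have [h3 h4] := IH ltj isp'; rewrite h2; split=> //; lia.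
have [Ej Ej1] := red j lt isq isp.
have Ept : pt w j.+1 = (pt w j).+1 by rewrite ptS // /op_at Ej addn1.
have Eqt : qt w j.+2 = (qt w j.+1).+1 by rewrite qtS // /op_at Ej1 addn1.
split; first by rewrite Ept.
have [E1 _] := wk_push ltj isq; have [E2 _] := support_pop lt isp.
(* The element [g] shows that the support of this pop is nonempty, so its head is the element just
   pushed. *)
have [_ _ ht _] := pop_exists wf lt isp; have [g hg Eg] := tm_surj wf ht.
have gs : g \in support w j.+1 by rewrite mem_support_pop // hg Eg ltnSn Eqt leqnn.
suff : pt w j.+1 \in support w j.+1.
  by rewrite mem_support_pop // -Eqt => /andP[_ /andP[]].
move: E2; rewrite E1 support_push_iota // Ept subSnn /=.
by case: (support w j.+1) gs => // x s _ [<- _]; rewrite inE add1n eqxx.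
Qed.

Lemma reduced_npushed w t : well_formed w -> reduced w -> 0 < t <= op_seq_size w ->
  0 < npushed w t <= op_seq_size w /\ tm w (npushed w t) <= t.
Proof.
move=> wf red ht; rewrite npushed_qb //; have [lt lo hi] := qbP wf ht.
have [h1 h2] := reduced_pop_max wf red lt (qb_pop wf ht).
by rewrite h1 pt_le; split=> //; lia.
Qed.

(** The element numbered [npushed x t] has left by time [t], also in [y] because the outputs agree,
    so [y] has pushed at least that many elements by then. Symmetry gives equality. *)
Lemma reduced_qlist a b : well_formed a -> well_formed b -> reduced a -> reduced b ->
  op_seq_size a = op_seq_size b -> produced_perm a = produced_perm b -> qlist 0 a = qlist 0 b.
Proof.
have half x y t : well_formed x -> well_formed y -> reduced x -> 0 < t <= op_seq_size x ->
    op_seq_size x = op_seq_size y -> produced_perm x = produced_perm y ->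
    npushed x t <= npushed y t.
  move=> wfx wfy redx ht En Epi; have [h1 h2] := reduced_npushed wfx redx ht.
  have Etm : tm x (npushed x t) = tm y (npushed x t) by rewrite /tm En Epi.
  rewrite En in h1 ht; apply: leq_trans (le_npushed wfy h1) _.
  by apply: npushed_mono; rewrite -?Etm // Etm tm_rng.
move=> wfa wfb reda redb En Epi.
apply: (@eq_from_nth _ 0); first by rewrite !size_qlist -wfa.2.2 -wfb.2.2.
move=> t; rewrite size_qlist -wfa.2.2 => lt.
have ht : 0 < t.+1 <= op_seq_size a by [].
apply/eqP; rewrite eqn_leq (half a b t.+1) //=.
by apply: (half b a t.+1) => //; rewrite -En.
Qed.

(** Equality of sizes follows from the length of the produced permutation. *)
Lemma rf_step_equivalent a b : rf_step a b -> equivalent a b.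
Proof.
move=> [wfa [wfb [i [k [j [l [R' [F' [_ _ _ _ Ep]]]]]]]]].
by split=> //; rewrite -(pi_size wfa) -(pi_size wfb) Ep.
Qed.

Theorem mainTheorem13 (alpha beta : seq op) :
  well_formed alpha -> well_formed beta -> reduced alpha -> reduced beta ->
  (equivalent alpha beta <->
   exists gs : seq (seq op), rf_chain alpha gs /\ last alpha gs = beta).
Proof.
move=> wfa wfb reda redb; split=> [[En Epi]|[gs [chain <-]]].
  exact: equal_qlist_connected (reduced_qlist wfa wfb reda redb En Epi).
elim: gs alpha {wfa reda} chain => [|g gs IH] alpha //= [rel /IH[En Epi]].
suff [En' Epi'] : equivalent alpha g by split; [rewrite En' | rewrite Epi'].
by case: rel => /rf_step_equivalent[E1 E2]; split.
Qed.
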